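(* Let $X$ be the Banach space defined in the context. For every $\alpha<\omega_1$ there is a weakly null sequence $(x_n)$ in $X$ whose averaging index satisfies $o(A,\tfrac12)\ge\alpha$.
   Context: **The space $X$.** Let $\mathcal T=\bigcup_{n\ge1}\{(\alpha_1,\dots,\alpha_n):\alpha_i<\omega^\omega\}$ be the tree of nonempty finite sequences of ordinals below $\omega^\omega$, ordered by initial segments ($s>t$ means $t$ is a proper initial segment of $s$), and let $\overline{\mathcal T}$ be $\mathcal T$ together with all infinite sequences of ordinals below $\omega^\omega$. $|s|$ is the length of $s$ and $s(j)$ its $j$-th coordinate. $C_0(\omega^\omega)$ is the space of continuous real functions on the ordinals $\le\omega^\omega$ (order topology) vanishing at $\omega^\omega$, with the sup norm. $X_0$ is the linear space of functions $F=(f_t)_{t\in\mathcal T}$ from $\mathcal T$ to $C_0(\omega^\omega)$ that are nonzero at only finitely many $t$. For $s\in\overline{\mathcal T}$ and an integer $1\le i<|s|$ define the linear functional $$L_{(s,i)}(F)=\sum_{t\in\mathcal T,\ t<s,\ i\le|t|<|s|}f_t\big(s(|t|+1)\big).$$ The pair $(s,i)$ is called a segment and is identified with the set of nodes of length at least $i$ which are above $s$ (i.e. $t<s$, $|t|\ge i$). If $j\le i$, the segments $(s,i)$ and $(t,j)$ are incomparable if they are disjoint and $t(m)\ne s(m)$ for some $m\le j$. Put $$\|F\|=\sup\Big\{\Big(\sum_j\big[L_{(s_j,i_j)}(F)\big]^2\Big)^{1/2}:\{(s_j,i_j)\}\text{ pairwise incomparable segments}\Big\}.$$ $X$ is the completion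 of $X_0$ under this norm. **Averaging index.** For a sequence $(e_i)$ in a normed space of bounded functions (sup norm), $$\ell^1\text{-}SP((e_i))=\lim_k\lim_m\inf\Big\{k^{-1}\Big\|\sum_{i=1}^ke_{n_i}\Big\|:m\le n_1<n_2<\dots<n_k\Big\}.$$ Let $(e_j)$ be a normalized weakly null sequence in $X$ and $\epsilon>0$, with the $e_j$ regarded as functions on $B_{X^*}$ with the $w^*$ topology. Put $A_0=B_{X^*}$; $A_{\alpha+1}(\epsilon,(e_j),B_{X^*})$ is the set of $x^*\in A_\alpha$ such that for every neighborhood $\mathcal N$ of $x^*$ relative to $A_\alpha$ there is an infinite $L\subset\mathbb N$ with $\ell^1\text{-}SP((e_i|_{\mathcal N})_{i\in L})\ge\epsilon$; $A_\beta=\bigcap_{\alpha<\beta}A_\alpha$ for limit $\beta$. $o(A,\epsilon)$ is the largest ordinal $\alpha$ with $A_\alpha(\epsilon,(e_j),B_{X^*})\ne\emptyset$. *)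

(* Defs.v *)
From HB Require Import structures.
From mathcomp Require Import all_boot all_order all_algebra.
From mathcomp Require Import all_classical all_reals all_analysis.
Set Implicit Arguments.
Unset Strict Implicit.
Unset Printing Implicit Defensive.
Import Order.TTheory GRing.Theory Num.Theory.
Import numFieldNormedType.Exports.
Local Open Scope classical_set_scope.
Local Open Scope ring_scope.

(** * The ordinals below, and up to, omega ^ omega *)

(* The ordinal w^n_1 + ... + w^n_k < w^w in Cantor normal form
   (n_1 >= ... >= n_k) is encoded by its sequence of exponents; the ordering
   of ordinals is then the lexicographic ordering, the empty sequence being 0. *)
Definition ordww : Type :=
  {s : seqlexi_with Order.default_display nat | sorted geq (s : seq nat)}.
HB.instance Definition _ := Choice.on ordww.
HB.instance Definition _ := SubType.on ordww.
HB.instance Definition _ :=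
  [SubChoice_isSubOrder of ordww by <: with Order.default_display].

Definition ordww0 : ordww := exist _ ([::] : seq nat) isT.

(* [None] is the ordinal w^w itself. *)
Definition ordww1 : Type := option ordww.
HB.instance Definition _ := Choice.on ordww1.

Definition ordww1_le (x y : ordww1) : bool :=
  match x, y with
  | _, None => true
  | None, Some _ => false
  | Some a, Some b => (a <= b)%O
  end.

Lemma ordww1_le_anti : antisymmetric ordww1_le.
Proof. by case=> [a|] [b|] //= /le_anti ->. Qed.

Lemma ordww1_le_trans : transitive ordww1_le.
Proof. by case=> [a|] [b|] [c|] //=; exact: le_trans. Qed.

Lemma ordww1_le_total : total ordww1_le.
Proof. by case=> [a|] [b|] //=; exact: le_total. Qed.

HB.instance Definition _ := Order.isOrder.Build Order.default_display ordww1
  (fun _ _ => erefl) (fun _ _ => erefl) (fun _ _ => erefl)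
  ordww1_le_anti ordww1_le_trans ordww1_le_total.

(** * The tree, its branches and its segments *)

Definition node : Type := {t : seq ordww | t != [::]}.
HB.instance Definition _ := Choice.on node.
HB.instance Definition _ := SubType.on node.

Definition len (t : node) : nat := size (val t).

(* finite nonempty, or infinite, sequences of ordinals below w^w *)
Definition branch : Type := (node + (nat -> ordww))%type.
HB.instance Definition _ := Choice.on branch.

(* The [j]-th coordinate [s(j)], where [j] starts from 1. *)
Definition coord (s : branch) (j : nat) : ordww :=
  match s with
  | inl t => nth ordww0 (val t) j.-1
  | inr u => u j.-1
  end.

(* [i < |s|] *)
Definition lt_length (i : nat) (s : branch) : bool :=
  if s is inl t then (i < len t)%N else true.

(* [t < s], i.e., [t] is a proper initial segment of [s] *)
Definition initial (t : node) (s : branch) : Prop :=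
  lt_length (len t) s /\
  forall m, (1 <= m <= len t)%N -> coord (inl t) m = coord s m.

Definition is_segment (p : branch * nat) : Prop :=
  (1 <= p.2)%N /\ lt_length p.2 p.1.

Definition segment_nodes (p : branch * nat) : set node :=
  [set t | initial t p.1 /\ (p.2 <= len t)%N].

Definition incomparable (p q : branch * nat) : Prop :=
  segment_nodes p `&` segment_nodes q = set0 /\
  exists2 m, (1 <= m <= minn p.2 q.2)%N & coord p.1 m <> coord q.1 m.

Definition incomparable_family (P : set (branch * nat)) : Prop :=
  P `<=` is_segment /\
  forall p q, P p -> P q -> p <> q -> incomparable p q.

(** * The space X_0 and its completions *)

Section X0.
Variable R : realType.

Definition C0 (f : ordww1 -> R) : Prop :=
  continuous (f : order_topology ordww1 -> R) /\ f None = 0.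

Definition X0_pred : {pred node -> ordww1 -> R} :=
  fun F => `[< (forall t, C0 (F t)) /\ finite_set [set t | F t <> 0] >].

Lemma X0_submod_closed : submod_closed X0_pred.
Proof.
split; first apply/asboolP; first split.
- by move=> t; split=> //; exact: (@cst_continuous _ R 0).
- by rewrite (_ : [set _ | _] = set0) // -subset0 => t /=; apply.
move=> a F G /asboolP[F0 Ffin] /asboolP[G0 Gfin]; apply/asboolP; split.
  move=> t; have [Fc Ft] := F0 t; have [Gc Gt] := G0 t; split.
    move=> x.
    apply: (@continuousD R R^o _ (fun y : order_topology ordww1 => a * F t y) (G t) x).
      by apply: continuousM; [exact: cst_continuous | exact: Fc].
    exact: Gc.
  rewrite -[LHS]/(a * F t None + G t None).
  by rewrite Ft Gt mulr0 addr0.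
apply: (@sub_finite_set _ _ ([set t | F t <> 0] `|` [set t | G t <> 0])).
  move=> t /= FGt; have [Ft|] := pselect (F t = 0); last by left.
  right=> Gt; apply: FGt.
  by rewrite -[LHS]/(a *: F t + G t) Ft Gt scaler0 addr0.
by rewrite finite_setU.
Qed.
HB.instance Definition _ :=
  GRing.isSubmodClosed.Build R _ X0_pred X0_submod_closed.

Definition X0 : Type := {F : node -> ordww1 -> R | F \in X0_pred}.
HB.instance Definition _ := Choice.on X0.
HB.instance Definition _ := SubType.on X0.
HB.instance Definition _ := [SubChoice_isSubLmodule of X0 by <:].

Definition segment_fun (p : branch * nat) (F : X0) : R :=
  \sum_(t \in segment_nodes p) val F t (Some (coord p.1 (len t).+1)).

(* The sum is finitely supported: [F] is, and every node lies in at most one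
   member of [P]. *)
Definition X0_norm (F : X0) : R :=
  sup [set Num.sqrt (\sum_(p \in P) segment_fun p F ^+ 2) |
       P in incomparable_family].

End X0.

(* [X] with [j] is the completion of X_0 (it is unique up to an isometry). *)
Definition is_completion (R : realType) (X : completeNormedModType R)
    (j : {linear X0 R -> X}) : Prop :=
  (forall F, `|j F| = X0_norm F) /\ dense (range j).

(** * The averaging index *)

Section AveragingIndex.
Variable R : realType.

Definition sup_norm (S : Type) (N : set S) (g : S -> R) : R :=
  sup [set `|g x| | x in N].

(* l^1-SP of the functions [g_0|N, g_1|N, ...]; when these are uniformly
   bounded both limits exist: the infimum is nondecreasing in [m], and [k] times
   the inner limit is subadditive in [k]. *)
Definition l1SP (S : Type) (N : set S) (g : nat -> S -> R) : R :=
  limn (fun k : nat => limn (fun m : nat =>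
    inf [set k%:R^-1 * sup_norm N (fun x => \sum_(i < k) g (n i) x) |
         n in [set n : 'I_k -> nat | (forall i, (m <= n i)%N) /\
                                     {homo n : i i' / (i < i')%N}]])).

Variable X : normedModType R.

Definition weakly_null (x : nat -> X) : Prop :=
  forall f : {linear X -> R^o}, continuous f -> f (x n) @[n --> \oo] --> (0 : R).

(* The unit ball of X^*; [{ptws X -> R}] carries the topology of pointwise
   convergence, which induces the w^* topology on X^*. *)
Definition dual_ball : set {ptws X -> R} :=
  [set f | linear (f : X -> R^o) /\ forall x, `|f x| <= `|x|].

Variables (eps : R) (e : nat -> X).

(* The neighborhoods of [f] relative to [A] are the [U `&` A] for [U] a
   neighborhood of [f], and an infinite set of integers is given by its
   increasing enumeration [phi]. *)
Definition derived (A : set {ptws X -> R}) : set {ptws X -> R} :=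
  [set f | A f /\ forall U, nbhs f U ->
     exists2 phi : nat -> nat, {homo phi : i i' / (i < i')%N} &
       eps <= l1SP (U `&` A) (fun i (h : {ptws X -> R}) => h (e (phi i)))].

Variables (d : Order.disp_t) (W : orderType d).
Hypothesis wfW : well_founded (fun v w : W => (v < w)%O).

(* [w = v + 1] *)
Definition is_succ (v w : W) : Prop :=
  (v < w)%O /\ forall u, (u < w)%O -> (u <= v)%O.

Definition derived_step (w : W)
    (A : forall v, (v < w)%O -> set {ptws X -> R}) : set {ptws X -> R} :=
  match pselect (exists v, is_succ v w) with
  | left h => derived (A (sval (cid h)) (svalP (cid h)).1)
  | right _ => dual_ball `&` [set f | forall v (vw : (v < w)%O), A v vw f]
  end.

(* The transfinite sequence [A_w], for [w] in the well-ordered set [W]; it is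
   specified by the three lemmas that follow. *)
Definition derived_set : W -> set {ptws X -> R} := Fix wfW _ derived_step.

Lemma derived_setE w :
  derived_set w = derived_step (fun v (_ : (v < w)%O) => derived_set v).
Proof.
rewrite /derived_set Fix_eq // => {}w A B AB.
by congr derived_step; do 2![apply: functional_extensionality_dep => ?].
Qed.

Lemma derived_set0 w : (forall v, (w <= v)%O) -> derived_set w = dual_ball.
Proof.
move=> w0; rewrite derived_setE /derived_step; case: pselect => [h|_].
  by have [v [vw _]] := h; have := w0 v; rewrite leNgt vw.
rewrite -[RHS]setIT; congr (_ `&` _); apply/seteqP; split=> // f _ v vw.
by have := w0 v; rewrite leNgt vw.
Qed.

Lemma derived_setS v w : is_succ v w -> derived_set w = derived (derived_set v).
Proof.
move=> vw; rewrite derived_setE /derived_step; case: pselect => [h|]; last first.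
  by case; exists v.
case: (cid h) => u uw /=; congr (derived (derived_set _)); apply/le_anti.
by rewrite vw.2 ?uw.1 // uw.2 // vw.1.
Qed.

Lemma derived_set_sub_ball w : derived_set w `<=` dual_ball.
Proof.
elim/(well_founded_ind wfW): w => w IH; rewrite derived_setE /derived_step.
case: pselect => [h|_]; last by move=> f [].
by case: (cid h) => u uw /= f [/(IH _ uw.1)].
Qed.

Lemma derived_set_lim w : (exists v, (v < w)%O) -> ~ (exists v, is_succ v w) ->
  derived_set w = \bigcap_(v in [set v | (v < w)%O]) derived_set v.
Proof.
move=> [v vw] Nw; rewrite derived_setE /derived_step; case: pselect => // _.
apply/seteqP; split=> f; first by move=> [_].
by move=> Af; split=> //; exact: derived_set_sub_ball (Af v vw).
Qed.

(* [o] is the largest element of [W] with [A_o] nonempty. *)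
Definition is_averaging_index (o : W) : Prop :=
  derived_set o !=set0 /\ forall w, derived_set w !=set0 -> (w <= o)%O.

End AveragingIndex.

(* Main.v *)
Require Import Defs.
From HB Require Import structures.
From mathcomp Require Import all_boot all_order all_algebra.
From mathcomp Require Import all_classical all_reals all_analysis.
From mathcomp Require Import finmap ring lra.
Set Implicit Arguments.
Unset Strict Implicit.
Unset Printing Implicit Defensive.
Import Order.TTheory GRing.Theory Num.Theory.
Import numFieldNormedType.Exports.
Local Open Scope classical_set_scope.
Local Open Scope ring_scope.

(** In [C_0(w^w)] the indicator functions [g_n] of the sets [schreier_set n]
    behave like a Schreier basis.  On the one hand, finitely many [g_n] whose
    indices are at least [K], where [K] is at least their number, take the value 1
    at a common ordinal with leading exponent [K], hence as close to [w^w] as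
    desired when [K] is large ([common_descents]).  On the other hand, if
    [g_n b = 1], then at most [n + 1] of these functions do not vanish at [b]
    ([card_descends]), which makes [(g_n)] weakly null.

    Ranks are assigned to nodes of the tree so that nodes of length 1 have rank
    [alpha], ranks strictly decrease from a node to its ranked children, and the
    children of a node of rank [v] have ranks that eventually reach any given
    element below [v] or exceed it when their last coordinate tends to [w^w] ([ranked_tree]).
    The sequence is [x_n = j (spike t_n n)], a copy of [g_n] placed at a ranked
    node [t_n], where every ranked node is [t_n] for infinitely many [n].

    The index is at least [alpha].  Summing the values along the path to a node
    [s] gives a functional of norm at most 1, and the functionals of the children
    of [s] tend weak-star to that of [s] as their last coordinate tends to [w^w]
    ([child_functionals_cvg]).  Moreover the functional of a suitable
    child takes the value 1 at any given finite number of [x_n] located at [s], if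
    their indices are large enough.  So, by induction, the path functional of a node
    of rank [v] belongs to the [v]-th derived set ([path_functional_derived]): on
    its neighborhoods, the averages of far enough [x_n] located at [s] have norm 1.

    The sequence is weakly null.  Let [f] be a bounded functional and
    [delta > 0].  At a single node only finitely many spikes satisfy
    [f >= delta], because suitable averages of them have bounded partial sums
    ([spike_null]).  Spikes located at nodes that extend different children of one node
    are carried by an antichain, where the norm is that of [l^2], so only finitely
    many children are extended by the node of such a spike
    ([finite_heavy_children]).  As ranks
    decrease along the tree, well-founded induction shows that [f x_n >= delta]
    for finitely many [n] only ([spikes_finite]).

    Finally the index exists ([averaging_index_exists]).  A nonempty derived set
    [A_w] meets an open set [large_on F], with [F] a finite set of integers, which
    misses the next derived set ([derived_avoids]).  As the sets decrease, [F]
    determines [w], so an uncountable well-order reaches an empty derived set; by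
    weak-star compactness the first empty one has an immediate predecessor. *)

(** * Clopen sets of ordinals forming a Schreier family *)
Notation lex := (seqlexi_with Order.default_display nat).

Lemma ltxi_rcons0 (b c : lex) : (c < (rcons b 0%N : lex))%O = (c <= b)%O.
Proof.
elim: b c => [|x b IH] [|y c] //.
- rewrite /= ltxi_cons lexis0 ltxis0 leEnat /= andbF; exact/esym/eqP.
- by rewrite /= ltxi_cons lexi_cons IH.
Qed.

(** If [e] is at most the last exponent of [a], the interval from [a] (excluded)
    to [a + w^e] (included) consists of the sums [a + c] with [0 < c <= w^e]; in
    terms of exponents, [a] is a proper prefix that is followed by an exponent
    less than [e], or by [e] alone. *)
Lemma rcons_itvE (a b : lex) (e : nat) :
  (a < b)%O && (b <= (rcons a e : lex))%O =
  [&& take (size a) b == a, (size a < size b)%N &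
    (nth 0%N b (size a) < e)%N ||
    (nth 0%N b (size a) == e) && (size b == (size a).+1)].
Proof.
elim: a b => [|x a IH] [|y b] //=.
- have bE : ((size b).+1 == 1)%N = (b == [::]) by case: b.
  rewrite bE lexi_cons lexis0 leEnat.
  by case: (ltngtP y e) => //=.
- rewrite ltxi_cons lexi_cons leEnat ltnS eqseq_cons.
  by rewrite eqSS -andbA; case: (ltngtP x y) => //=.
Qed.

Lemma sorted_rcons_geq (s : seq nat) e :
  sorted geq s -> (e <= last e s)%N -> sorted geq (rcons s e).
Proof. by case: s => //= x s sS es; rewrite rcons_path sS. Qed.

(** This is the ordinal sum [a + w^e] only when [e] is at most the last exponent of
    [a]; for [e = 0] it is the successor of [a]. *)
Definition oadd (a : ordww) (e : nat) : ordww :=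
  insubd ordww0 (rcons (val a) e : lex).

Lemma val_oadd (a : ordww) e :
  (e <= last e (val a))%N -> val (oadd a e) = rcons (val a) e :> seq nat.
Proof. by move=> ea; rewrite val_insubd sorted_rcons_geq //; exact: (valP a). Qed.

Lemma val_osucc (a : ordww) : val (oadd a 0) = rcons (val a) 0%N :> seq nat.
Proof. exact: val_oadd. Qed.

Lemma lt_osucc (a c : ordww) : (c < oadd a 0)%O = (c <= a)%O.
Proof. by rewrite leEsub ltEsub val_osucc ltxi_rcons0. Qed.

(** The positions [n] at which the exponents of [b] drop, together with the last
    but one position.  The latter makes the sets below clopen: it adds the supremum
    of the ordinals whose exponents drop at [n] with given first exponents.  The
    bound on the leading exponent keeps each of these sets away from [w^w]. *)
Definition descends (n : nat) (b : seq nat) : bool :=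
  [&& (head 0 b <= n)%N, (n.+1 < size b)%N &
      (nth 0 b n.+1 < nth 0 b n)%N || (size b == n.+2)].

Definition schreier_set (n : nat) : set ordww1 :=
  [set x | if x is Some b then descends n (val b) else false].

Lemma le_Some (a b : ordww) : (Some a <= Some b :> ordww1)%O = (a <= b)%O.
Proof. by []. Qed.

Lemma lt_Some (a b : ordww) : (Some a < Some b :> ordww1)%O = (a < b)%O.
Proof. by rewrite !lt_neqAle le_Some. Qed.

Lemma oadd_last_itvE n (a b : ordww) : size (val a) = n.+1 ->
  (Some b \in `]Some a : ordww1, Some (oadd a (last 0%N (val a)))]) =
  [&& take n.+1 (val b) == val a, (n.+1 < size (val b))%N &
    (nth 0%N (val b) n.+1 < last 0 (val a))%N ||
    (nth 0%N (val b) n.+1 == last 0 (val a)) && (size (val b) == n.+2)].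
Proof.
move=> sa; rewrite -sa -rcons_itvE -val_oadd; last first.
  by case: (val a : seq nat) sa.
by rewrite (@in_itv _ ordww1) /= lt_Some le_Some ltEsub leEsub.
Qed.

(** The first [n + 1] exponents [a] range over a finite set ([finite_short]), and
    once they are fixed the condition describes an interval. Finitely many intervals
    of the form [`]a, c]], which are clopen, remain. *)
Lemma schreier_setE n : schreier_set n =
  \bigcup_(a in [set a : ordww | size (val a) = n.+1 /\ (head 0%N (val a) <= n)%N])
    `]Some a : ordww1, Some (oadd a (last 0%N (val a)))]%classic.
Proof.
apply/seteqP; split=> [[b|] //=|x [a [sa ha]]].
- case/and3P => hb sb bn.
  have sS : sorted geq (take n.+1 (val b)) by apply: take_sorted; exact: (valP b).
  have sz : size (take n.+1 (val b)) = n.+1 by rewrite size_take sb.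
  exists (exist _ (take n.+1 (val b) : lex) sS) => /=.
    by split=> //; case: (val b : seq nat) hb.
  rewrite (@oadd_last_itvE n (exist _ (take n.+1 (val b) : lex) sS)) //= eqxx sb /=.
  rewrite (last_nth 0) sz [nth _ (_ :: _) _]/= nth_take //.
  case/orP: bn => [->//|bn]; rewrite bn andbT orbC -leq_eqVlt.
  have := valP b => /(sorted_leq_nth (rev_trans leq_trans) leqnn 0); apply => //.
  by rewrite inE ltnW.
- case: x => [b|] //; rewrite -[X in X -> _]/(is_true (_ \in _)).
  rewrite (@oadd_last_itvE n) // => /and3P[/eqP ba sb bn]; apply/and3P; split => //.
    by move: ha; rewrite -ba; case: (val b : seq nat).
  move: bn; rewrite -ba (last_nth 0) size_take sb [nth _ (_ :: _) _]/= nth_take //.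
  by case/orP => [->//|/andP[_ ->]]; rewrite orbT.
Qed.

Lemma finite_short n :
  finite_set [set a : ordww | size (val a) = n.+1 /\ (head 0%N (val a) <= n)%N].
Proof.
pose f (t : n.+1.-tuple 'I_n.+1) : ordww := insubd ordww0 (map val t : lex).
apply: (@sub_finite_set _ _ (f @` setT)); last exact/finite_image/finite_finset.
move=> a [sa ha].
have st : size (map (inord : nat -> 'I_n.+1) (val a)) == n.+1 by rewrite size_map sa.
exists (Tuple st) => //; apply: val_inj; rewrite /f /=.
have E : map val (map (inord : nat -> 'I_n.+1) (val a)) = val a :> seq nat.
  rewrite -map_comp -[RHS]map_id; apply/eq_in_map => x xa /=; rewrite inordK // ltnS.
  apply: leq_trans ha; move: (valP a) xa; case: (val a : seq nat) => //= y s ys.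
  rewrite inE => /predU1P[->//|].
  by move/allP: (order_path_min (rev_trans leq_trans) ys); apply.
by rewrite val_insubd E ifT //; exact: (valP a).
Qed.

Lemma schreier_set_open n : open (schreier_set n : set (order_topology ordww1)).
Proof.
rewrite schreier_setE; apply: bigcup_open => a _.
rewrite (_ : mkset _ = `]Some a : order_topology ordww1,
                         Some (oadd (oadd a (last 0%N (val a))) 0)[%classic).
  exact: itv_open.
by apply/seteqP; split=> -[b|] /=;
   rewrite !(@in_itv _ ordww1) /= ?lt_Some ?lt_osucc.
Qed.

Lemma schreier_set_closed n : closed (schreier_set n : set (order_topology ordww1)).
Proof.
rewrite schreier_setE; apply: closed_bigcup; first exact: finite_short.
move=> a _.
rewrite (_ : mkset _ = `[Some (oadd a 0) : order_topology ordww1,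
                         Some (oadd a (last 0%N (val a)))]%classic).
  exact: itv_closed.
by apply/seteqP; split=> -[b|] /=; rewrite !(@in_itv _ ordww1) /=
   ?lt_Some ?le_Some ?(leNgt (oadd _ _)) ?lt_osucc -?ltNge.
Qed.

Lemma clopen_indic_continuous (R : realType) (T : topologicalType) (D : set T) :
  open D -> closed D -> continuous (\1_D : T -> R).
Proof.
move=> oD cD x; have [Dx|Dx] := pselect (D x).
  apply: (@cvg_trans _ (nbhs (1 : R))); last by rewrite indicE mem_set.
  apply: cvg_near_cst; near=> y; rewrite indicE mem_set//.
  by near: y; exact: open_nbhs_nbhs.
apply: (@cvg_trans _ (nbhs (0 : R))); last by rewrite indicE memNset.
apply: cvg_near_cst; near=> y; rewrite indicE memNset//.
by near: y; apply: open_nbhs_nbhs; split=> //; exact: closed_openC.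
Unshelve. all: by end_near.
Qed.

Lemma schreier_indic_C0 (R : realType) n : C0 (\1_(schreier_set n) : ordww1 -> R).
Proof.
split; last by rewrite indicE memNset.
apply: clopen_indic_continuous; [exact: schreier_set_open|exact: schreier_set_closed].
Qed.

Lemma ordww_nonincr (b : ordww) (i k : nat) : (i <= k)%N -> (k < size (val b))%N ->
  (nth 0 (val b) k <= nth 0 (val b) i)%N.
Proof.
move=> ik kb; have := valP b.
move/(sorted_leq_nth (rev_trans leq_trans) leqnn 0); apply => //.
by rewrite inE (leq_ltn_trans ik).
Qed.

(** If [n < m] are both in [l], the exponents of [b] drop strictly between the
    positions [n] and [m], since [n] cannot be the last but one position.  So the
    elements of [l] are separated by the exponents at these positions, which are at
    most the leading exponent. *)
Lemma card_descends (b : ordww) (l : seq nat) : uniq l ->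
  {in l, forall n, descends n (val b)} -> (size l <= (head 0 (val b)).+1)%N.
Proof.
move=> ul lb; pose f := nth 0%N (val b).
have f_inj n m : n \in l -> m \in l -> (n < m)%N -> (f m < f n)%N.
  move=> /lb/and3P[_ nb nd] /lb/and3P[_ mb md] nm.
  have mn : (f m <= f n.+1)%N by apply: ordww_nonincr => //; exact: ltnW.
  case/orP: nd => [|/eqP nd]; first exact: leq_ltn_trans.
  by move: mb; rewrite nd !ltnS leqNgt nm.
rewrite -(size_map f l) -[X in (_ <= X)%N](size_iota 0); apply: uniq_leq_size.
  rewrite map_inj_in_uniq // => n m nl ml fnm.
  by case: (ltngtP n m) => // [/(f_inj _ _ nl ml)|/(f_inj _ _ ml nl)]; rewrite fnm ltnn.
move=> _ /mapP[n /lb/and3P[_ nb _] ->]; rewrite mem_iota ltnS -nth0 /=.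
by apply: ordww_nonincr => //; exact: ltnW.
Qed.

(** Start with the exponent [K] and lower it by one just after each position in
    [l]; stop one step after the last of these positions. *)
Lemma common_descents (l : seq nat) (K : nat) : (size l <= K)%N ->
  {in l, forall n, (K <= n)%N} ->
  exists2 b : ordww, head 0%N (val b) = K & {in l, forall n, descends n (val b)}.
Proof.
move=> lK Kl; pose M := \max_(i <- l) i.
pose s := mkseq (fun i => K - count (fun n => n < i)%N l)%N M.+2.
have sS : sorted geq s.
  apply: (@homo_sorted _ _ _ leq); last exact: iota_sorted.
  move=> i k ik /=; apply: leq_sub2l; apply: sub_count => n /= ni.
  exact: leq_trans ik.
exists (exist _ (s : lex) sS) => [|n nl].
  by rewrite /= (eq_count (a2 := pred0)) // count_pred0 subn0.
have nM : (n <= M)%N by apply: leq_bigmax_seq.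
apply/and3P; split.
- by rewrite /= (eq_count (a2 := pred0)) // count_pred0 subn0 Kl.
- by rewrite size_mkseq.
- have [nltM|Mn] := ltnP n M; last by rewrite size_mkseq !eqSS eqn_leq nM Mn orbT.
  rewrite [val _]/= /s !nth_mkseq ?ltnS // ?(leq_trans nM) //.
  apply/orP; left.
  have c1 : (count (fun m => m < n)%N l < count (fun m => m < n.+1)%N l)%N.
    have -> : count (fun m => m < n.+1)%N l =
        (count (fun m => m < n)%N l + count_mem n l)%N.
      rewrite -count_predUI [X in (_ + X)%N](eq_count (a2 := pred0)) ?count_pred0 ?addn0.
        by apply: eq_count => m /=; rewrite ltnS leq_eqVlt orbC.
      by move=> m /=; case: ltngtP.
    by rewrite -addn1 leq_add2l -has_count has_pred1.
  have c2 := count_size (fun m => m < n.+1)%N l.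
  by apply: ltn_sub2l => //; apply: leq_trans c1 _; apply: leq_trans c2 _.
Qed.

Lemma descends_nseq0 n : exists b : ordww, descends n (val b).
Proof.
have sS : sorted geq (nseq n.+2 0%N) by rewrite /=; elim: n.
exists (exist _ (nseq n.+2 0%N : lex) sS).
by rewrite /descends /= size_nseq eqxx orbT ltnSn.
Qed.

(** * Segment functionals and the norm *)
Section Segments.
Variable R : realType.
Implicit Types (F G : X0 R) (p : branch * nat) (l : seq node).

Lemma val_linear a F G t x :
  val (a *: F + G) t x = a * val F t x + val G t x.
Proof. by []. Qed.

Definition supported F l : Prop := forall t, t \notin l -> val F t = 0.

Lemma X0_supported F : exists2 l, uniq l & supported F l.
Proof.
have /asboolP[_ /finite_fsetP[A AE]] := valP F.
exists (enum_fset A); first exact: fset_uniq.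
move=> t tA; apply: contra_notP (negP tA) => Ft.
by have : [set` A] t by rewrite -AE.
Qed.

Lemma segment_funE p F l : uniq l -> supported F l ->
  segment_fun p F =
  \sum_(t <- l | t \in segment_nodes p) val F t (Some (Defs.coord p.1 (len t).+1)).
Proof.
move=> ul Fl; rewrite bigfs //; last by move=> t _ /Fl ->.
by rewrite set_mem_set.
Qed.

Lemma segment_fun_is_linear p : linear (segment_fun p : X0 R -> R^o).
Proof.
move=> a F G; have [l ul Fl] := X0_supported F; have [m um Gm] := X0_supported G.
have uk := undup_uniq (l ++ m).
have Fk : supported F (undup (l ++ m)).
  by move=> t; rewrite mem_undup mem_cat negb_or => /andP[/Fl].
have Gk : supported G (undup (l ++ m)).
  by move=> t; rewrite mem_undup mem_cat negb_or => /andP[_ /Gm].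
have Hk : supported (a *: F + G) (undup (l ++ m)).
  by move=> t tk; apply/funext => x; rewrite val_linear Fk // Gk //= mulr0 addr0.
rewrite !(segment_funE _ uk) // scaler_sumr -big_split /=.
by apply: eq_bigr => t _; exact: val_linear.
Qed.
HB.instance Definition _ p :=
  GRing.isLinear.Build R (X0 R) R^o _ (@segment_fun R p) (segment_fun_is_linear p).

(** The set of numbers of which [X0_norm F] is by definition the supremum. *)
Definition segment_sums F : set R :=
  [set Num.sqrt (\sum_(p \in P) segment_fun p F ^+ 2) |
       P in incomparable_family].

Lemma segment_sums0 F : segment_sums F 0.
Proof.
exists set0; first by split.
by rewrite fsbig_set0 sqrtr0.
Qed.

Lemma subset_incomparable (P Q : set (branch * nat)) :
  Q `<=` P -> incomparable_family P -> incomparable_family Q.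
Proof.
by move=> QP [PS PI]; split=> [p /QP/PS//|p q /QP Pp /QP Pq]; exact: PI.
Qed.

(** A sum with infinite support is 0, so bounding finite subsums bounds the sum in
    all cases. *)
Lemma fsum_le (I : choiceType) (P : set I) (f : I -> R) (M : R) : 0 <= M ->
  (forall s, uniq s -> [set` s] `<=` P -> \sum_(i <- s) f i <= M) ->
  \sum_(i \in P) f i <= M.
Proof.
move=> M0 PM; apply: PM => //; case: finite_supportP => // A AP _ _.
Qed.

Lemma ubound_segment_sums F (M : R) : 0 <= M ->
  (forall s, uniq s -> incomparable_family [set` s] ->
     \sum_(p <- s) segment_fun p F ^+ 2 <= M) ->
  ubound (segment_sums F) (Num.sqrt M).
Proof.
move=> M0 FM _ [P PI <-]; rewrite ler_sqrt //.
apply: fsum_le => // s us sP; apply: FM => //; exact: subset_incomparable PI.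
Qed.

Lemma segment_sums_seq F (s : seq (branch * nat)) :
  uniq s -> incomparable_family [set` s] ->
  segment_sums F (Num.sqrt (\sum_(p <- s) segment_fun p F ^+ 2)).
Proof. by move=> us sI; exists [set` s] => //; rewrite -fsbig_seq. Qed.

Lemma incomparable_sum_le1 (s : seq (branch * nat)) (t : node) (c : R) :
  0 <= c -> uniq s -> incomparable_family [set` s] ->
  \sum_(p <- s | t \in segment_nodes p) c <= c.
Proof.
move=> c0 us [_ sI].
have [/hasP[p ps tp]|/hasPn st] := boolP (has (fun p => t \in segment_nodes p) s).
  rewrite big_mkcond (bigD1_seq p) //= tp big1_seq ?addr0 // => q /andP[qp qs].
  case: ifPn => // tq.
  have [+ _] := sI q p qs ps (elimN eqP qp).
  move=> qp0; exfalso; suff : set0 t by [].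
  by rewrite -qp0; split; exact: set_mem.
by rewrite big_seq_cond big1 // => q /andP[/st/negP].
Qed.

(** On an antichain the norm is dominated by the [l^2] norm: a segment sees at most
    one node of [l], and incomparable segments are disjoint, so that no node is
    counted twice. *)
Lemma antichain_ubound F l (a : node -> R) : uniq l -> supported F l ->
  (forall p, {in l &, forall t u, segment_nodes p t -> segment_nodes p u -> t = u}) ->
  (forall t b, t \in l -> `|val F t (Some b)| <= a t) ->
  ubound (segment_sums F) (Num.sqrt (\sum_(t <- l) a t ^+ 2)).
Proof.
move=> ul Fl l1 Fa.
apply: ubound_segment_sums => [|s us sI]; first by apply: sumr_ge0 => t _; exact: sqr_ge0.
have Lp p : segment_fun p F ^+ 2 <= \sum_(t <- l | t \in segment_nodes p) a t ^+ 2.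
  rewrite (segment_funE _ ul Fl).
  have [/hasP[t tl tp]|/hasPn st] :=
    boolP (has (fun t => t \in segment_nodes p) l); last first.
    rewrite big_seq_cond big1 ?expr0n /= ?sumr_ge0 // => [t _|t /andP[/st/negP]//].
    exact: sqr_ge0.
  rewrite big_mkcond (bigD1_seq t) //= tp big1_seq ?addr0 => [|u /andP[ut ul']]; last first.
    by case: ifPn => // up; rewrite (l1 p t u) ?eqxx // in ut; exact: set_mem.
  rewrite [leRHS]big_mkcond [leRHS](bigD1_seq t) //= tp ler_wpDr ?sumr_ge0 // => [u _|].
    by case: ifP => // _; exact: sqr_ge0.
  rewrite -real_normK ?num_real // lerXn2r ?nnegrE ?Fa //.
  by rewrite (le_trans _ (Fa t (Defs.coord p.1 (len t).+1) tl)).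
apply: le_trans (ler_sum _ (fun p _ => Lp p)) _.
rewrite (exchange_big_dep predT) //=; apply: ler_sum => t _.
exact: incomparable_sum_le1 (sqr_ge0 _) us sI.
Qed.

End Segments.

(** * Spikes and path functionals *)
Section Spikes.
Variable R : realType.
Implicit Types (F G : X0 R) (s t : node) (b : ordww).

Definition spike_fun t n : node -> ordww1 -> R :=
  fun u => if u == t then \1_(schreier_set n) else 0.

Lemma spike_X0 t n : spike_fun t n \in @X0_pred R.
Proof.
apply/asboolP; split=> [u|].
  rewrite /spike_fun; case: ifP => _; first exact: schreier_indic_C0.
  by split=> //; exact: (@cst_continuous _ R 0).
apply: (@sub_finite_set _ _ [set t]) => // u /=.
by rewrite /spike_fun; case: eqP.
Qed.

Definition spike t n : X0 R := exist _ (spike_fun t n) (spike_X0 t n).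

Lemma spikeE t n u b :
  val (spike t n) u (Some b) = ((u == t) && descends n (val b))%:R.
Proof.
rewrite /= /spike_fun; case: eqP => //= _; rewrite indicE; congr (nat_of_bool _)%:R.
by apply/idP/idP => [/set_mem//|nb]; exact: mem_set.
Qed.

Lemma spike_supported t n : supported (spike t n) [:: t].
Proof. by move=> u; rewrite inE /= /spike_fun => /negbTE ->. Qed.

Lemma rcons_neq0 (s : seq ordww) b : rcons s b != [::].
Proof. by case: s. Qed.

Definition child (s : seq ordww) b : node :=
  exist _ (rcons s b) (rcons_neq0 s b).

Lemma initialP t s :
  initial t (inl s) <-> (len t < len s)%N /\ take (len t) (val s) = val t.
Proof.
split=> -[ts E]; split=> //.
  apply: (@eq_from_nth _ ordww0); first by rewrite size_takel // ltnW.
  move=> i; rewrite size_takel ?(ltnW ts) // => it.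
  by rewrite nth_take // -[i in LHS]/(i.+1.-1) -[LHS]/(Defs.coord (inl s) i.+1) -E.
move=> m /andP[m0 mt]; rewrite /= -E nth_take //.
by rewrite prednK.
Qed.

Lemma node_gt0 s : (0 < len s)%N.
Proof. by rewrite /len lt0n size_eq0; exact: (valP s). Qed.

Lemma path_nodesP t s : segment_nodes (inl s, 1%N) t <->
  (len t < len s)%N /\ take (len t) (val s) = val t.
Proof. by rewrite -initialP; split=> [[]|ts] //; split=> //=; exact: node_gt0. Qed.

(** For a node of length 1 the pair is not a segment, but then no node is a
    proper initial segment of [s] and this functional is 0. *)
Definition path_functional s F : R := segment_fun (inl s, 1%N) F.

Lemma path_nodes_child s b t :
  segment_nodes (inl (child (val s) b), 1%N) t <->
  t = s \/ segment_nodes (inl s, 1%N) t.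
Proof.
rewrite !path_nodesP /len /= size_rcons ltnS -cats1; split=> [[]|].
  rewrite leq_eqVlt => /predU1P[ts|ts]; last by rewrite takel_cat ?(ltnW ts) //; right.
  by rewrite take_cat ts ltnn subnn cats0 => E; left; exact: val_inj.
case=> [->|[ts E]]; first by rewrite take_cat ltnn subnn cats0 leqnn.
by rewrite takel_cat (ltnW ts).
Qed.

Lemma path_functional_child s b F :
  path_functional (child (val s) b) F = val F s (Some b) + path_functional s F.
Proof.
have [l ul Fl] := X0_supported F.
have uk := undup_uniq (s :: l).
have Fk : supported F (undup (s :: l)).
  by move=> t; rewrite mem_undup inE negb_or => /andP[_ /Fl].
have sk : s \in undup (s :: l) by rewrite mem_undup mem_head.
rewrite /path_functional !(segment_funE _ uk Fk) big_mkcond [in RHS]big_mkcond.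
rewrite (bigD1_seq s) //= [in RHS](bigD1_seq s) //=.
rewrite mem_set; last by apply/path_nodes_child; left.
rewrite memNset ?add0r; last by move/path_nodesP; rewrite ltnn => -[].
congr (_ + _); first by rewrite /len nth_rcons ltnn eqxx.
apply: eq_bigr => t ts.
have -> : (t \in segment_nodes (inl (child (val s) b), 1%N)) =
          (t \in segment_nodes (inl s, 1%N)).
  apply/idP/idP => /set_mem H; apply/mem_set.
    by case/path_nodes_child: H ts => [->|//]; rewrite eqxx.
  by apply/path_nodes_child; right.
by case: ifP => // /set_mem/path_nodesP[tl _]; rewrite /= nth_rcons tl.
Qed.

Lemma path_functional_spike s n : path_functional s (spike s n) = 0.
Proof.
rewrite /path_functional (@segment_funE _ _ _ [:: s]) //; last exact: spike_supported.
by rewrite big_mkcond big_seq1 memNset // => /path_nodesP[]; rewrite ltnn.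
Qed.

Lemma path_functional_child_spike s b n :
  path_functional (child (val s) b) (spike s n) = (descends n (val b))%:R.
Proof. by rewrite path_functional_child path_functional_spike addr0 spikeE eqxx. Qed.

Lemma ubound_spike t n : ubound (segment_sums (spike t n)) 1.
Proof.
have := @antichain_ubound R (spike t n) [:: t] (fun=> 1) isT (@spike_supported t n).
rewrite big_seq1 expr1n sqrtr1; apply => [p u v|u b _].
  by rewrite !inE => /eqP-> /eqP->.
by rewrite spikeE; case: (_ && _); rewrite ?normr1 ?normr0.
Qed.

Lemma X0_norm_le F (M : R) : ubound (segment_sums F) M -> X0_norm F <= M.
Proof. by move=> FM; apply: ge_sup => //; exists 0; exact: segment_sums0. Qed.

Lemma path_functional_le_sums s F : has_ubound (segment_sums F) ->
  `|path_functional s F| <= X0_norm F.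
Proof.
move=> Fb; have [s1|s1] := ltnP 1 (len s); last first.
  rewrite /path_functional /segment_fun fsbig1 ?normr0 => [|t /path_nodesP[]].
    by apply: ub_le_sup => //; exact: segment_sums0.
  by move=> /leq_trans/(_ s1); rewrite ltnS leqNgt node_gt0.
rewrite -sqrtr_sqr; apply: ub_le_sup => //.
have := @segment_sums_seq R F [:: (inl s, 1%N)] isT.
rewrite big_seq1; apply; split=> [p|p q]; rewrite /= !inE; first by move/eqP->.
by move/eqP-> => /eqP->.
Qed.

Lemma X0_norm_spike t n : X0_norm (spike t n) = 1.
Proof.
apply/le_anti; rewrite X0_norm_le ?ubound_spike //=; last exact: ubound_spike.
have [b bn] := descends_nseq0 n.
have /le_trans : `|path_functional (child (val t) b) (spike t n)| <= X0_norm (spike t n).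
  by apply: path_functional_le_sums; exists 1; exact: ubound_spike.
by rewrite path_functional_child_spike bn normr1; exact.
Qed.

Lemma sqrB_le (x y : R) : (x - y) ^+ 2 <= 2 * x ^+ 2 + 2 * y ^+ 2.
Proof.
have -> : 2 * x ^+ 2 + 2 * y ^+ 2 = (x - y) ^+ 2 + (x + y) ^+ 2 by ring.
by rewrite lerDl sqr_ge0.
Qed.

Lemma has_ubound_segment_sumsB F G : has_ubound (segment_sums F) ->
  has_ubound (segment_sums G) -> has_ubound (segment_sums (F - G)).
Proof.
move=> [M FM] [N GN].
have M0 : 0 <= M by apply: FM; exact: segment_sums0.
have N0 : 0 <= N by apply: GN; exact: segment_sums0.
exists (Num.sqrt (2 * M ^+ 2 + 2 * N ^+ 2)); apply: ubound_segment_sums => [|s us sI].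
  by rewrite addr_ge0 // mulr_ge0 // sqr_ge0.
have sq H K : 0 <= K -> ubound (segment_sums H) K ->
    \sum_(p <- s) segment_fun p H ^+ 2 <= K ^+ 2.
  move=> K0 /(_ _ (segment_sums_seq H us sI)) HK.
  have S0 : 0 <= \sum_(p <- s) segment_fun p H ^+ 2.
    by apply: sumr_ge0 => p _; exact: sqr_ge0.
  by rewrite -[leLHS](sqr_sqrtr S0); apply: lerXn2r; rewrite ?nnegrE ?sqrtr_ge0.
apply: (@le_trans _ _ (2 * \sum_(p <- s) segment_fun p F ^+ 2 +
                       2 * \sum_(p <- s) segment_fun p G ^+ 2)); last first.
  by apply: lerD; rewrite ler_wpM2l // sq.
rewrite !mulr_sumr -big_split /=; apply: ler_sum => p _.
have -> : segment_fun p (F - G) = segment_fun p F - segment_fun p G :> R.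
  exact: (raddfB (segment_fun p)).
exact: sqrB_le.
Qed.
End Spikes.

(** * The norm is finite, and path functionals are contractions *)
Section Completion.
Variables (R : realType) (X : completeNormedModType R) (j : {linear X0 R -> X}).
Hypothesis Xcompl : is_completion j.
Implicit Types (F G : X0 R) (s t : node).

(** The supremum of an unbounded set is 0 by convention, and [X0_norm] is a norm
    pulled back along the linear map [j].  If the sums of [F] were unbounded, so
    would be those of [F + G] for a spike [G]; then [j F = 0] and [j (F + G) = 0],
    whence [j G = 0], although [G] has norm 1. *)
Lemma has_ubound_segment_sums F : has_ubound (segment_sums F).
Proof.
apply: contrapT => Fub; pose G := spike R (child [::] ordww0) 0.
have jF H : ~ has_ubound (segment_sums H) -> j H = 0.
  move=> Hub; apply/normr0_eq0; rewrite Xcompl.1; apply: sup_out.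
  by case=> _.
have FG : ~ has_ubound (segment_sums (F + G)).
  move=> FGub; apply: Fub; rewrite -(addrK G F).
  apply: has_ubound_segment_sumsB => //; exists 1; exact: ubound_spike.
have : `|j G| = 1 by rewrite Xcompl.1 X0_norm_spike.
have := jF _ FG; rewrite raddfD /= jF // add0r => ->.
by rewrite normr0 => /esym/eqP; rewrite oner_eq0.
Qed.

Lemma norm_spike t n : `|j (spike R t n)| = 1.
Proof. by rewrite Xcompl.1 X0_norm_spike. Qed.

Lemma path_functional_le s F : `|path_functional s F| <= `|j F|.
Proof.
by rewrite Xcompl.1; apply: path_functional_le_sums; exact: has_ubound_segment_sums.
Qed.

End Completion.

(** * Extension of functionals from a dense subspace *)
Section Extension.
Variables (R : realType) (V : lmodType R) (X : normedModType R).
Variables (j : {linear V -> X}) (L : V -> R).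
Hypothesis (j_dense : dense (range j)).
Hypothesis (L_linear : linear (L : V -> R^o)).
Hypothesis (L_le : forall v, `|L v| <= `|j v|).

Lemma dense_approx (x : X) (e : R) : 0 < e -> exists v, `|x - j v| < e.
Proof.
move=> e0; have [|y [xy [v _ vy]]] := j_dense (O := ball x e) _ (ball_open x e).
  by exists x; exact: ballxx.
by exists v; move: xy; rewrite -ball_normE vy.
Qed.

Lemma functionalB v w : L (v - w) = L v - L w.
Proof. by rewrite addrC -scaleN1r L_linear scaleN1r addrC. Qed.

(** McShane's formula extends a 1-Lipschitz function on the range of [j] to a
    1-Lipschitz function; as it is linear on a dense subspace, it is linear. *)
Definition mcshane (x : X) : R := sup [set L v - `|x - j v| | v in [set: V]].

Lemma mcshane_has_ubound x : has_ubound [set L v - `|x - j v| | v in [set: V]].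
Proof.
exists `|x| => _ [v _ <-]; rewrite lerBlDr (le_trans (ler_norm _)) //.
rewrite (le_trans (L_le v)) //.
by rewrite -[X in `|X| <= _](subKr x) ler_normB.
Qed.

Lemma mcshane_range v : mcshane (j v) = L v.
Proof.
apply/le_anti/andP; split.
  apply: ge_sup; first by exists (L v - `|j v - j v|); exists v.
  move=> _ [w _ <-]; rewrite lerBlDr -lerBlDl -functionalB distrC -raddfB.
  exact: le_trans (ler_norm _) (L_le _).
apply: ub_le_sup; first exact: mcshane_has_ubound.
by exists v => //; rewrite subrr normr0 subr0.
Qed.

Lemma mcshane_lipschitz x y : `|mcshane x - mcshane y| <= `|x - y|.
Proof.
have le1 u w : mcshane u - mcshane w <= `|u - w|.
  rewrite lerBlDl; apply: ge_sup; first by exists (L 0 - `|u - j 0|); exists 0.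
  move=> _ [v _ <-].
  have wv : L v - `|w - j v| <= mcshane w.
    by apply: ub_le_sup; [exact: mcshane_has_ubound|exists v].
  have := ler_normD (w - u) (u - j v); rewrite addrA subrK (distrC w u).
  by move: wv; lra.
by rewrite ler_norml lerNl opprB distrC !le1 distrC le1.
Qed.

Lemma mcshane_linear : linear (mcshane : X -> R^o).
Proof.
move=> a x y; apply/eqP; rewrite -subr_eq0 -normr_le0; apply/ler_addgt0Pl => e e0.
rewrite addr0.
pose d := e / (2 * (`|a| + 1)).
have a1 : 0 < `|a| + 1 by rewrite ltr_wpDl.
have d0 : 0 < d by rewrite divr_gt0 // mulr_gt0.
have [v xv] := dense_approx x d0; have [w yw] := dense_approx y d0.
have Lx := mcshane_lipschitz x (j v); have Ly := mcshane_lipschitz y (j w).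
have Lz := mcshane_lipschitz (a *: x + y) (j (a *: v + w)).
rewrite !mcshane_range L_linear in Lx Ly Lz.
have zvw : `|a *: x + y - j (a *: v + w)| <= `|a| * d + d.
  rewrite linearP opprD addrACA -scalerBr (le_trans (ler_normD _ _)) // lerD ?(ltW yw) //.
  by rewrite normrZ ler_wpM2l // ltW.
have -> : mcshane (a *: x + y) - (a *: (mcshane x : R^o) + mcshane y) =
    (mcshane (a *: x + y) - (a * L v + L w)) - a * (mcshane x - L v) -
    (mcshane y - L w) :> R.
  by rewrite /GRing.scale /=; ring.
have ed : e = (`|a| * d + d) + `|a| * d + d.
  have -> : `|a| * d + d + `|a| * d + d = d * (2 * (`|a| + 1)) by ring.
  by rewrite divfK // gt_eqF // mulr_gt0.
rewrite ed; apply: le_trans (ler_normB _ _) _; apply: lerD.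
  apply: le_trans (ler_normB _ _) _; apply: lerD; first exact: le_trans zvw.
  by rewrite normrM ler_wpM2l // (le_trans Lx) // ltW.
by rewrite (le_trans Ly) // ltW.
Qed.

Lemma extend_contraction : exists2 h : X -> R, dual_ball h & forall v, h (j v) = L v.
Proof.
exists mcshane; last exact: mcshane_range.
split; first exact: mcshane_linear.
have L0 : L 0 = 0 by rewrite -(subrr (0 : V)) functionalB subrr.
move=> x; have := mcshane_lipschitz x (j 0).
by rewrite mcshane_range L0 subr0 raddf0 subr0.
Qed.

End Extension.

(** * Estimates of the spreading model constant *)
Section SpreadingModels.
Variable R : realType.

(** A divergent sequence has limit 0 by convention. This gives upper bounds for
    [l1SP] without any proof of convergence. *)
Lemma limn_le_bound (u : nat -> R) (c : R) : 0 <= c ->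
  (\forall n \near \oo, u n <= c) -> limn u <= c.
Proof.
move=> c0 uc; have [ucvg|/dvgP->//] := pselect (cvg (u @ \oo)).
exact: limr_le.
Qed.

Lemma sup_norm_ge0 (S : Type) (N : set S) (g : S -> R) : 0 <= sup_norm N g.
Proof.
rewrite /sup_norm; set A := [set _ | _ in _].
have [[[y [x Nx xy]] Ab]|/sup_out->//] := pselect (has_sup A).
by apply: (@le_trans _ _ `|g x|) => //; apply: ub_le_sup => //; exists x.
Qed.

Lemma sup_norm_le (S : Type) (N : set S) (g : S -> R) (c : R) : 0 <= c ->
  (forall x, N x -> `|g x| <= c) -> sup_norm N g <= c.
Proof.
move=> c0 gc; have [[x Nx]|N0] := pselect (N !=set0).
  by apply: ge_sup; [exists `|g x|, x|move=> _ [y Ny <-]; exact: gc].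
rewrite /sup_norm (_ : [set _ | _ in _] = set0) ?sup0 //.
by rewrite -subset0 => y [x Nx _]; apply: N0; exists x.
Qed.

(** The set of numbers whose infimum occurs in [l1SP]. *)
Definition far_averages (S : Type) (N : set S) (g : nat -> S -> R) (k m : nat) :=
  [set k%:R^-1 * sup_norm N (fun x => \sum_(i < k) g (n i) x) |
     n in [set n : 'I_k -> nat | (forall i, (m <= n i)%N) /\
                                 {homo n : i i' / (i < i')%N}]].

Lemma far_averages_bounds (S : Type) (N : set S) (g : nat -> S -> R) (c : R)
    (M k m : nat) :
  0 <= c -> (forall i x, (M <= i)%N -> N x -> `|g i x| <= c) -> (M <= m)%N ->
  forall y, far_averages N g k m y -> 0 <= y <= c.
Proof.
move=> c0 gc Mm _ [n [mn _] <-]; rewrite mulr_ge0 ?sup_norm_ge0 //= ?invr_ge0 //.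
case: k n mn => [|k] n mn; first by rewrite invr0 mul0r.
rewrite mulrC ler_pdivrMr // sup_norm_le ?mulr_ge0 // => x Nx.
apply: le_trans (ler_norm_sum _ _ _) _.
apply: (@le_trans _ _ (\sum_(i < k.+1) c)).
  by apply: ler_sum => i _; apply: gc => //; exact: leq_trans (mn i).
by rewrite sumr_const card_ord mulr_natr.
Qed.

Lemma far_averages_nonempty (S : Type) (N : set S) (g : nat -> S -> R) (k m : nat) :
  far_averages N g k m !=set0.
Proof.
eexists; exists (fun i => m + i)%N => //; split=> [i|i i' ii']; first exact: leq_addr.
by rewrite ltn_add2l.
Qed.

Lemma l1SP_le (S : Type) (N : set S) (g : nat -> S -> R) (c : R) (M : nat) :
  0 <= c -> (forall i x, (M <= i)%N -> N x -> `|g i x| <= c) -> l1SP N g <= c.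
Proof.
move=> c0 gc; apply: limn_le_bound => //; apply: nearW => k.
apply: limn_le_bound => //; exists M => // m Mm.
rewrite -/(far_averages N g k m).
have B := far_averages_bounds c0 gc Mm.
have [y Fy] := far_averages_nonempty N g k m.
apply: (@le_trans _ _ y); last by have /andP[] := B _ _ Fy.
by apply: ge_inf => //; exists 0 => z /B /andP[].
Qed.

(** For every [k], the averages of length [k] that start far enough are all equal to
    1, so both limits are those of eventually constant sequences. *)
Lemma l1SP_eq1 (S : Type) (N : set S) (g : nat -> S -> R) :
  (forall i x, N x -> `|g i x| <= 1) ->
  (forall k : nat, exists M, forall n : 'I_k -> nat, (forall i, (M <= n i)%N) ->
     {homo n : i i' / (i < i')%N} ->
     exists2 x, N x & \sum_(i < k) g (n i) x = k%:R) ->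
  l1SP N g = 1.
Proof.
move=> g1 gN; apply: cvg_lim => //.
apply: (@cvg_trans _ (nbhs (1 : R))) => //; apply: cvg_near_cst.
near=> k; have k0 : (0 < k)%N by near: k; exact: nbhs_infty_gt.
apply: cvg_lim => //; apply: cvg_near_cst.
have [M MN] := gN k; exists M => // m Mm.
rewrite -/(far_averages N g k m).
suff -> : far_averages N g k m = [set 1] by rewrite inf1.
have F1 y : far_averages N g k m y -> y = 1.
  move=> Fy; apply/le_anti.
  have := far_averages_bounds ler01 (fun i x _ => g1 i x) (leq0n m) Fy.
  move=> /andP[_ ->] /=; case: Fy => n [mn nS] <-.
  have [x Nx gx] := MN n (fun i => leq_trans Mm (mn i)) nS.
  rewrite mulrC ler_pdivlMr ?ltr0n // mul1r.
  rewrite -[leLHS]gx; apply: le_trans (ler_norm _) _.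
  apply: ub_le_sup; last by exists x.
  exists k%:R => _ [z Nz <-]; apply: le_trans (ler_norm_sum _ _ _) _.
  apply: (@le_trans _ _ (\sum_(i < k) 1)); first by apply: ler_sum => i _; exact: g1.
  by rewrite sumr_const card_ord.
apply/seteqP; split=> y; first exact: F1.
by move=> ->; have [z Fz] := far_averages_nonempty N g k m; rewrite -(F1 _ Fz).
Unshelve. all: by end_near.
Qed.

End SpreadingModels.

(** * Weak-star compactness of the dual ball *)
Section DualBall.
Variables (R : realType) (X : normedModType R).

Lemma eval_continuous (x : X) : continuous (fun f : {ptws X -> R} => f x).
Proof. exact: (@proj_continuous X (fun=> R) x). Qed.

Lemma norm_eval_continuous (x : X) : continuous (fun f : {ptws X -> R} => `|f x|).
Proof.
move=> f; have E : (fun g : {ptws X -> R} => g x) @ f --> f x.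
  exact: eval_continuous.
exact: (cvg_norm E).
Qed.

Lemma dual_ball_closed : closed (@dual_ball R X).
Proof.
have -> : @dual_ball R X =
    (\bigcap_(axy in [set: R * X * X]) [set f : {ptws X -> R} |
       f (axy.1.1 *: axy.1.2 + axy.2) - (axy.1.1 * f axy.1.2 + f axy.2) = 0]) `&`
    \bigcap_(x in [set: X]) [set f : {ptws X -> R} | `|f x| <= `|x|].
  apply/seteqP; split=> f [fL f1].
    by split=> [[[a x] y] _|x _] /=; [rewrite fL subrr|exact: f1].
  split=> [a x y|x]; last exact: f1.
  by apply/eqP; rewrite -subr_eq0; apply/eqP; exact: (fL (a, x, y)).
apply: closedI.
  apply: closed_bigI => -[[a x] y] _ /=.
  apply: (@closed_comp _ _
    (fun f : {ptws X -> R} => f (a *: x + y) - (a * f x + f y)) [set 0]).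
    move=> f _.
    have E z : (fun g : {ptws X -> R} => g z) @ f --> f z by exact: eval_continuous.
    exact: (cvgB (E _) (cvgD (cvgM (cvg_cst a) (E x)) (E y))).
  exact: closed_eq.
apply: closed_bigI => x _ /=.
apply: (@closed_comp _ _ (fun f : {ptws X -> R} => `|f x|) [set r | r <= `|x|]).
  by move=> f _; exact: norm_eval_continuous.
exact: closed_le.
Qed.

Lemma dual_ball_compact : compact (@dual_ball R X).
Proof.
apply: (subclosed_compact dual_ball_closed); last first.
  move=> f [_ f1]; have H x : `[- `|x|, `|x|]%classic (f x).
    by rewrite /= in_itv /= -ler_norml f1.
  exact: H.
apply: (@tychonoff X (fun=> R) (fun x => `[- `|x|, `|x|]%classic)) => x.
exact: segment_compact.
Qed.

(** [D] may be empty, hence the mention of the dual ball in the conclusion. *)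
Lemma nested_nonempty (d : Order.disp_t) (I : orderType d) (D : set I)
    (A : I -> set {ptws X -> R}) :
  (forall i, D i -> closed (A i)) -> (forall i, D i -> A i !=set0) ->
  (forall i, D i -> A i `<=` @dual_ball R X) ->
  (forall i k, D i -> D k -> (i <= k)%O -> A k `<=` A i) ->
  exists2 f, dual_ball f & forall i, D i -> A i f.
Proof.
move=> Acl A0 Ab Adec; have [[i0 Di0]|D0] := pselect (D !=set0); last first.
  exists (fun=> 0); last by move=> i Di; exfalso; apply: D0; exists i.
  by split=> [a x y|x]; rewrite ?normr0 // scaler0 addr0.
have dir i k : D i -> D k -> exists2 m, D m & A m `<=` A i `&` A k.
  move=> Di Dk; have [ik|/ltW ki] := leP i k.
    by exists k => // f Af; split=> //; exact: Adec Af.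
  by exists i => // f Af; split=> //; exact: Adec Af.
have FF : ProperFilter (filter_from D A).
  by apply: filter_from_proper => //; apply: filter_from_filter; [exists i0|].
have [|f [fb fA]] := dual_ball_compact FF; first by exists i0 => //; exact: Ab.
exists f => // i Di; apply: (Acl _ Di) => U Uf; apply: fA => //.
by exists i.
Qed.

End DualBall.

(** * Existence of the averaging index *)
Section AveragingIndexExists.
Variables (R : realType) (X : normedModType R) (eps : R) (e : nat -> X).
Hypothesis eps0 : 0 < eps.
Hypothesis e_null : forall f, dual_ball f -> f (e n) @[n --> \oo] --> (0 : R).
Implicit Types (A : set {ptws X -> R}) (F : seq nat).

Lemma derived_closed A : closed A -> closed (derived eps e A).
Proof.
move=> Acl f fA; split.
  by apply: Acl => U /fA [g [[Ag _] Ug]]; exists g.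
move=> U /nbhs_interior /fA [g [[_ gA] Ug]]; exact: gA.
Qed.

Definition large_on F : set {ptws X -> R} :=
  [set f | forall i, i \in F -> eps / 2 < `|f (e i)|].

Lemma large_on_open F : open (large_on F).
Proof.
elim: F => [|i F IH].
  by rewrite (_ : large_on _ = setT); [exact: openT|apply/seteqP; split].
have -> : large_on (i :: F) =
    (fun f : {ptws X -> R} => `|f (e i)|) @^-1` [set r | eps / 2 < r] `&` large_on F.
  apply/seteqP; split=> f.
    by move=> H; split=> [|k kF]; apply: H; rewrite ?mem_head // inE kF orbT.
  by move=> [fi fF] k; rewrite inE => /predU1P[->//|/fF].
apply: openI => //; apply: open_comp; last exact: open_gt.
by move=> f _; exact: norm_eval_continuous.
Qed.

(** If [large_on F] meets [A] and all the values [f (e i)] with [i >= N] are at most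
    [eps / 2] in absolute value on [large_on F `&` A], then no point of [large_on F]
    is in the derived set.  If this never happened, [F] could be enlarged forever by
    larger and larger integers, and by compactness some [f] in [A] would satisfy
    [eps / 2 <= `|f (e i)|] for infinitely many [i]. *)
Lemma derived_avoids A : closed A -> A `<=` @dual_ball R X -> A !=set0 ->
  exists2 F, (large_on F `&` A !=set0) & large_on F `&` derived eps e A = set0.
Proof.
move=> Acl Ab A0; apply: contrapT => noF.
have step (FN : seq nat * nat) : exists i, large_on FN.1 `&` A !=set0 ->
    (FN.2 <= i)%N /\ large_on (i :: FN.1) `&` A !=set0.
  case: FN => F N /=.
  have [FA|] := pselect (large_on F `&` A !=set0); last by exists 0%N.
  have [[f [Ff [Af fA]]]|/set0P/negP/negPn/eqP dF] :=
    pselect (large_on F `&` derived eps e A !=set0); last first.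
    by exfalso; apply: noF; exists F.
  apply: contrapT => /forallNP noi.
  have [phi phiS] := fA _ (open_nbhs_nbhs (conj (large_on_open F) Ff)).
  have e2 : eps / 2 < eps by move: eps0; lra.
  apply/negP; rewrite -ltNge; apply: le_lt_trans e2.
  apply: (@l1SP_le _ _ _ _ _ N) => [|i h Ni [Fh Ah]]; first by move: eps0; lra.
  rewrite leNgt; apply/negP => hi; apply: (noi (phi i)) => _; split.
    by apply: leq_trans Ni _; elim: (i) => // m /leq_ltn_trans; apply; exact: phiS.
  by exists h; split=> // k; rewrite inE => /predU1P[->//|/Fh].
have [c cP] := choice step.
pose G := fix G n := if n is m.+1 then c (G m, m) :: G m else [::].
have GA n : large_on (G n) `&` A !=set0.
  elim: n => [|n IH] /=; last by have [] := cP (G n, n) IH.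
  by have [f Af] := A0; exists f.
(* Large inequalities make these sets closed. *)
pose K n : set {ptws X -> R} :=
  [set f | A f /\ forall i, i \in G n -> eps / 2 <= `|f (e i)|].
have GS n m : (n <= m)%N -> {subset G n <= G m}.
  elim: m => [|m IH]; first by rewrite leqn0 => /eqP->.
  rewrite leq_eqVlt => /predU1P[->//|/IH nm] i /nm im.
  by rewrite inE im orbT.
have [||||f fb fK] := @nested_nonempty R X _ nat setT K.
- move=> n _; rewrite (_ : K n = A `&`
      \bigcap_(i in [set i | i \in G n]) [set f | eps / 2 <= `|f (e i)|]).
    apply: closedI => //; apply: closed_bigI => i _.
    apply: (@closed_comp _ _ (fun f : {ptws X -> R} => `|f (e i)|)
                         [set r | eps / 2 <= r]).
      by move=> f _; exact: norm_eval_continuous.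
    exact: closed_ge.
  by apply/seteqP; split=> f [].
- by move=> n _; have [f [Gf Af]] := GA n; exists f; split=> // i /Gf /ltW.
- by move=> n _ f [/Ab].
- by move=> n m _ _ nm f [Af fm]; split=> // i /(GS _ _ nm); exact: fm.
have e20 : 0 < eps / 2 by move: eps0; lra.
have /cvgr0Pnorm_lt/(_ _ e20)[N _ fN] := e_null fb.
have [+ _] := cP (G N, N) (GA N) => /= Nc.
have := fN _ Nc; rewrite /= ltNge => /negP; apply.
have [_] := fK N.+1 I; apply; exact: mem_head.
Qed.

Variables (d : Order.disp_t) (W : orderType d).
Hypothesis wfW : well_founded (fun v w : W => (v < w)%O).
Hypothesis uncountableW : ~ countable [set: W].
Local Notation A := (derived_set eps e wfW).

Lemma derived_set_closed w : closed (A w).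
Proof.
elim/(well_founded_ind wfW): w => w IH; rewrite derived_setE /derived_step.
case: pselect => [h|_].
  by case: (cid h) => u uw /=; apply: derived_closed; exact: IH uw.1.
apply: closedI; first exact: dual_ball_closed.
rewrite (_ : [set f | _] = \bigcap_(v in [set v | (v < w)%O]) A v) //.
by apply: closed_bigI => v; exact: IH.
Qed.

Lemma derived_set_ltS v w : (v < w)%O -> A w `<=` derived eps e (A v).
Proof.
elim/(well_founded_ind wfW): w v => w IH v vw.
have [[u uw]|wlim] := pselect (exists u, is_succ u w).
  have := uw.2 _ vw; rewrite le_eqVlt => /predU1P[->|vu].
    by rewrite (derived_setS _ _ _ uw).
  by rewrite (derived_setS _ _ _ uw) => f [/(IH _ uw.1 _ vu)].
rewrite derived_set_lim //; last by exists v.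
move=> f fA; have [u [vu uw]] : exists u, (v < u)%O /\ (u < w)%O.
  apply: contrapT => nou; apply: wlim; exists v; split=> // u uw.
  by rewrite leNgt; apply/negP => vu; apply: nou; exists u.
by apply: IH vu _ _ => //; exact: fA.
Qed.

Lemma derived_set_decr v w : (v <= w)%O -> A w `<=` A v.
Proof.
by rewrite le_eqVlt => /predU1P[->//|/derived_set_ltS vw] f /vw[].
Qed.

(** Otherwise each [w] has a finite set [F w] given by [derived_avoids].  For
    [v < w], the set [large_on (F w)] meets [A w], which is contained in the set
    derived from [A v], while [large_on (F v)] misses the latter; so [F] is an
    injection into a countable type. *)
Lemma derived_set_vanishes : exists w, A w = set0.
Proof.
apply: contrapT => /forallNP A0.
have /choice[F FP] w : exists F, (large_on F `&` A w !=set0) /\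
    large_on F `&` derived eps e (A w) = set0.
  have [F F1 F2] := derived_avoids (@derived_set_closed w)
    (@derived_set_sub_ball _ _ _ _ _ _ wfW w) ((set0P _).1 (introN eqP (A0 w))).
  by exists F.
apply: uncountableW; apply/countable_injP; exists (choice.pickle \o F).
move=> v w _ _ /= /(pcan_inj choice.pickleK) vw.
wlog lt_vw : v w vw / (v < w)%O.
  by move=> H; have [/H|/H/esym|//] := ltgtP v w; apply.
have [[f [Ff fw]] _] := FP w; have [_ Fv] := FP v.
exfalso; suff : (large_on (F v) `&` derived eps e (A v)) f by rewrite Fv.
by split; [rewrite vw|exact: derived_set_ltS fw].
Qed.

Lemma averaging_index_exists : exists o : W, is_averaging_index eps e wfW o.
Proof.
have [w [w0 wmin]] : exists w, A w = set0 /\ forall v, (v < w)%O -> A v !=set0.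
  have [w] := derived_set_vanishes; elim/(well_founded_ind wfW): w => w IH w0.
  have [[v [vw v0]]|nov] := pselect (exists v, (v < w)%O /\ A v = set0).
    exact: IH vw v0.
  by exists w; split=> // v vw; apply/set0P/eqP => v0; apply: nov; exists v.
have [[p pw]|wlim] := pselect (exists u, is_succ u w).
  exists p; split=> [|v [f fv]]; first exact: wmin pw.1.
  rewrite leNgt; apply/negP => pv; have wv : (w <= v)%O.
    by rewrite leNgt; apply/negP => /(pw.2); rewrite leNgt pv.
  by have := derived_set_decr wv fv; rewrite w0.
exfalso; have [||||f fb fA] := @nested_nonempty R X _ W [set v | (v < w)%O] A.
- by move=> v _; exact: derived_set_closed.
- exact: wmin.
- by move=> v _; exact: derived_set_sub_ball.
- by move=> u v _ _; exact: derived_set_decr.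
suff : A w f by rewrite w0.
by rewrite derived_setE /derived_step; case: pselect.
Qed.

End AveragingIndexExists.

(** * Weak nullity *)
Lemma infinite_nat_uniq_seq (L : set nat) (N M : nat) : infinite_set L ->
  exists G : seq nat, [/\ uniq G, size G = N & forall i, i \in G -> (M <= i)%N /\ L i].
Proof.
move=> Linf; have far m : exists2 i, (m <= i)%N & L i.
  apply: contrapT => nofar; apply: Linf; apply: sub_finite_set (finite_II m) => i Li.
  by rewrite /= ltnNge; apply/negP => mi; apply: nofar; exists i.
elim: N => [|N [G [uG sG GL]]]; first by exists [::].
have [i mi Li] := far (maxn M (\max_(k <- G) k).+1).
move: mi; rewrite geq_max => /andP[Mi Gi].
exists (i :: G); split=> [||k]; rewrite /= ?sG //.
  rewrite uG andbT; apply/negP => iG.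
  by have := @leq_bigmax_seq _ _ xpredT id _ iG isT; rewrite leqNgt Gi.
by rewrite inE => /predU1P[->//|/GL].
Qed.

Section WeaklyNull.
Variables (R : realType) (X : completeNormedModType R) (j : {linear X0 R -> X}).
Hypothesis Xcompl : is_completion j.
Variables (f : {linear X -> R^o}) (C : R).
Hypothesis f_le : forall x, `|f x| <= C * `|x|.
Implicit Types (F : X0 R) (t : node) (G : seq nat) (delta : R).

Lemma bound_ge0 : 0 <= C.
Proof.
have := f_le (j (spike R (child [::] ordww0) 0)).
by rewrite (norm_spike Xcompl) mulr1; exact: le_trans.
Qed.

Lemma functional_bound F (M : R) :
  ubound (segment_sums F) M -> 0 <= M -> f (j F) <= C * M.
Proof.
move=> FM M0; apply: le_trans (ler_norm _) _; apply: le_trans (f_le _) _.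
by rewrite ler_wpM2l ?bound_ge0 // Xcompl.1 X0_norm_le.
Qed.

Lemma val_sum_spikes (I : eqType) (l : seq I) (t : I -> node) (n : I -> nat) u b :
  val (\sum_(i <- l) spike R (t i) (n i)) u (Some b) =
  \sum_(i <- l) ((u == t i) && descends (n i) (val b))%:R.
Proof.
elim: l => [|i l IH]; first by rewrite !big_nil.
rewrite !big_cons -IH -spikeE -[spike R (t i) (n i)]scale1r val_linear.
by rewrite scale1r mul1r.
Qed.

Lemma sum_spikes_supported (I : eqType) (l : seq I) (t : I -> node) (n : I -> nat) :
  supported (\sum_(i <- l) spike R (t i) (n i)) [seq t i | i <- l].
Proof.
elim: l => [|i l IH] u; first by rewrite big_nil.
rewrite /= inE negb_or big_cons => /andP[ui ul]; apply/funext => x.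
rewrite -[spike R (t i) (n i)]scale1r val_linear IH //.
by rewrite /= /spike_fun (negbTE ui) mulr0 addr0.
Qed.

Lemma sumr_const_seq (I : eqType) (s : seq I) (c : R) :
  \sum_(i <- s) c = c * (size s)%:R.
Proof.
by elim: s => [|i s IH]; rewrite ?big_nil ?mulr0 // big_cons IH /= -natr1; ring.
Qed.

Lemma bounded_multiples (delta B : R) :
  0 < delta -> (forall r : nat, r%:R * delta <= B) -> False.
Proof.
move=> d0 dB; have := dB (Num.bound (B / delta)).
rewrite -ler_pdivlMr // leNgt => /negP; apply.
apply: archi_boundP; rewrite divr_ge0 ?(ltW d0) //.
by have := dB 0%N; rewrite mul0r.
Qed.

(** Otherwise take successive averages of the spikes at [t] with [f >= delta], each of
    them over a set much larger than all the indices used before.  At an ordinal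
    where some previous spike does not vanish, few spikes of the new average do not
    vanish, by [card_descends], and the average is at most [2^-(r+1)]; elsewhere it is
    at most 1 and the previous ones vanish.  The partial sums have norm at most 2,
    but [f] is at least [r * delta] on the [r]-th one. *)
Lemma spike_null t delta : 0 < delta ->
  finite_set [set i | delta <= f (j (spike R t i))].
Proof.
move=> d0; apply: contrapT => Linf.
have blocks (r : nat) : exists F M, [/\ supported F [:: t],
    (forall b, 0 <= val F t (Some b) <= 2 - 2^-1 ^+ r),
    (forall b, val F t (Some b) != 0 -> exists2 n, (n < M)%N & descends n (val b)) &
    r%:R * delta <= f (j F)].
  elim: r => [|r [F [M [Ft F2 FM Fd]]]].
    have val0 b : val (0 : X0 R) t (Some b) = 0 by [].
    exists 0, 0%N; split=> [//|b|b|]; rewrite ?val0 ?eqxx //.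
      by rewrite lexx expr0; lra.
    by rewrite mul0r !raddf0.
  (* At most [M] spikes of the new average overlap an old one, so that their
     share is at most [2^-(r+1)]; the successor avoids an empty average. *)
  pose N := (M.+1 * 2 ^ r.+1)%N.
  have [G [uG sG GL]] := infinite_nat_uniq_seq N M Linf.
  have N0 : (0 < N)%N by rewrite muln_gt0 expn_gt0.
  have NR0 : 0 < N%:R :> R by rewrite ltr0n.
  pose S := \sum_(i <- G) spike R t i.
  have SE b : val S t (Some b) = (count (fun n => descends n (val b)) G)%:R.
    rewrite (@val_sum_spikes _ G (fun=> t) id) -sum1_count natr_sum [RHS]big_mkcond.
    by apply: eq_bigr => i _; rewrite eqxx; case: ifP.
  exists (N%:R^-1 *: S + F), (M + (\max_(k <- G) k).+1)%N; split=> [u ut|b|b|].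
  - apply/funext => x; rewrite val_linear Ft //.
    rewrite (@sum_spikes_supported _ G (fun=> t) id) ?mulr0 ?addr0 //.
    by apply: contra ut => /mapP[i _ ->]; rewrite mem_head.
  - rewrite val_linear SE; have /andP[F0 F2b] := F2 b.
    apply/andP; split; first by rewrite addr_ge0 // mulr_ge0 // invr_ge0 ltW.
    have [Fb|/FM[n nM nb]] := eqVneq (val F t (Some b)) 0.
      rewrite Fb addr0 mulrC ler_pdivrMr //.
      apply: (@le_trans _ _ N%:R); first by rewrite ler_nat -sG count_size.
      rewrite ler_peMl //.
      have : (2^-1 : R) ^+ r.+1 <= 1 by rewrite exprn_ile1 // invf_le1 // ler1n.
      lra.
    have cG : (count (fun n => descends n (val b)) G <= M)%N.
      rewrite -size_filter; apply: (@leq_trans (head 0%N (val b)).+1).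
        apply: card_descends; first exact: filter_uniq.
        by move=> k; rewrite mem_filter => /andP[].
      by apply: leq_ltn_trans nM; case/and3P: nb.
    have : N%:R^-1 * (count (fun n => descends n (val b)) G)%:R <= (2^-1 : R) ^+ r.+1.
      rewrite mulrC ler_pdivrMr // /N natrM natrX exprVn mulrCA mulVf ?mulr1 ?expf_neq0 //.
      by rewrite ler_nat (leq_trans cG).
    rewrite exprS; move: F2b; lra.
  - rewrite val_linear SE; have [->|/FM[n nM nb] _] := eqVneq (val F t (Some b)) 0.
      rewrite addr0 mulf_eq0 negb_or => /andP[_]; rewrite pnatr_eq0 -lt0n -has_count.
      move=> /hasP[n nG nb]; exists n => //.
      apply: leq_trans (leq_addl _ _); rewrite ltnS.
      exact: (@leq_bigmax_seq _ _ xpredT id _ nG isT).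
    by exists n => //; apply: leq_trans (leq_addr _ _).
  - have -> : f (j (N%:R^-1 *: S + F)) = N%:R^-1 * f (j S) + f (j F) :> R.
      by rewrite !linearP.
    have fS : delta * N%:R <= f (j S).
      rewrite /S !raddf_sum /= -sG -sumr_const_seq big_seq [leRHS]big_seq.
      apply: ler_sum => i iG.
      by have [] := GL i iG.
    rewrite -natr1 mulrDl mul1r addrC; apply: lerD => //.
    by rewrite ler_pdivlMl // mulrC.
apply: (@bounded_multiples delta (C * 2)) => // r.
have [F [M [Ft F2 _ Fd]]] := blocks r.
apply: le_trans Fd _; apply: functional_bound => //.
have := @antichain_ubound R F [:: t] (fun=> 2) isT Ft.
rewrite big_seq1 sqrtr_sqr ger0_norm //; apply => [p u v|u b].
  by rewrite !inE => /eqP-> /eqP->.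
rewrite inE => /eqP->; have /andP[F0 Fb] := F2 b; rewrite ger0_norm //.
by apply: le_trans Fb _; rewrite gerBl exprn_ge0 // invr_ge0.
Qed.

Variable node_at : nat -> node.

(** The indices of the spikes located at [s] or at nodes extending [s] on which [f]
    is at least [delta]. *)
Definition heavy delta (s : seq ordww) : set nat :=
  [set i | prefix s (val (node_at i)) /\ delta <= f (j (spike R (node_at i) i))].

Lemma prefix_rcons_coord (s : seq ordww) b t p : prefix (rcons s b) (val t) ->
  segment_nodes p t -> Defs.coord p.1 (size s).+1 = b.
Proof.
move=> /prefixP[c tE] [[_ tp] _]; rewrite -tp /= /len tE.
  by rewrite nth_cat size_rcons ltnSn nth_rcons ltnn eqxx.
by rewrite size_cat size_rcons addSn ltnS leq_addr.
Qed.

(** A segment fixes the coordinate that follows [s], so it sees at most one of the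
    nodes extending different children of [s].  If [N] children are involved,
    the sum of one spike for each has norm at most [sqrt N], while [f] is at least
    [N * delta] on it. *)
Lemma finite_heavy_children (s : seq ordww) delta : 0 < delta ->
  finite_set [set b | heavy delta (rcons s b) !=set0].
Proof.
move=> d0; apply: contrapT => Binf.
have /choice[n nP] (b : ordww) : exists i, heavy delta (rcons s b) !=set0 ->
    heavy delta (rcons s b) i.
  have [[i hi]|] := pselect (heavy delta (rcons s b) !=set0); first by exists i.
  by exists 0%N.
have size_le (l : seq ordww) : uniq l ->
    [set` l] `<=` [set b | heavy delta (rcons s b) !=set0] ->
    (size l)%:R * delta ^+ 2 <= C ^+ 2.
  move=> ul lB; pose F : X0 R := \sum_(b <- l) spike R (node_at (n b)) (n b).
  have nl b : b \in l -> heavy delta (rcons s b) (n b) by move=> /lB /nP.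
  have one_child p b c : b \in l -> c \in l -> segment_nodes p (node_at (n b)) ->
      segment_nodes p (node_at (n c)) -> b = c.
    move=> /nl[pb _] /nl[pc _] tb tc.
    by rewrite -(prefix_rcons_coord pb tb) (prefix_rcons_coord pc tc).
  have inj b c : b \in l -> c \in l -> node_at (n b) = node_at (n c) -> b = c.
    move=> bl cl E; have [[/prefixP[u Eu] _] [/prefixP[v Ev] _]] := (nl b bl, nl c cl).
    move: Eu; rewrite E Ev !cat_rcons => /eqP; rewrite eqseq_cat // eqxx /=.
    by rewrite eqseq_cons => /andP[/eqP->].
  have Fub : ubound (segment_sums F) (Num.sqrt (size l)%:R).
    have := @antichain_ubound R F [seq node_at (n b) | b <- l] (fun=> 1).
    rewrite sumr_const_seq expr1n mul1r size_map; apply.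
    - by rewrite map_inj_in_uniq.
    - exact: sum_spikes_supported.
    - move=> p _ _ /mapP[b bl ->] /mapP[c cl ->] tb tc.
      by rewrite (one_child p b c).
    - move=> _ c /mapP[b bl ->]; rewrite val_sum_spikes (bigD1_seq b) //= eqxx.
      rewrite big1_seq ?addr0 => [|b' /andP[bb' b'l]].
        by case: (descends _ _); rewrite ?normr1 ?normr0.
      by case: eqP => // E; rewrite (inj b b') // eqxx in bb'.
  have fF : delta * (size l)%:R <= f (j F).
    rewrite /F !raddf_sum /= -sumr_const_seq big_seq [leRHS]big_seq.
    by apply: ler_sum => b bl; have [] := nl b bl.
  have := le_trans fF (functional_bound Fub (sqrtr_ge0 _)).
  set N : R := (size l)%:R => dN.
  have N0 : 0 <= N by rewrite ler0n.
  have [Nz|Npos] := eqVneq N 0; first by rewrite Nz mul0r sqr_ge0.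
  have dC : delta * Num.sqrt N <= C.
    have sN : 0 < Num.sqrt N by rewrite sqrtr_gt0 lt_neqAle eq_sym Npos.
    by rewrite -(ler_pM2r sN) -mulrA -expr2 sqr_sqrtr.
  have -> : N * delta ^+ 2 = (delta * Num.sqrt N) ^+ 2.
    by rewrite exprMn sqr_sqrtr // mulrC.
  by rewrite lerXn2r // nnegrE ?bound_ge0 // mulr_ge0 // ?sqrtr_ge0 // ltW.
apply: (@bounded_multiples (delta ^+ 2) (C ^+ 2)) => [|r]; first exact: exprn_gt0.
have [B BB Br] := infinite_set_fset r Binf.
apply: le_trans (size_le (enum_fset B) (fset_uniq B) BB).
by rewrite ler_wpM2r ?ler_nat // sqr_ge0.
Qed.

Variables (d : Order.disp_t) (W : orderType d).
Hypothesis wfW : well_founded (fun v w : W => (v < w)%O).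
Variable rho : seq ordww -> option W.
Hypothesis rho_lt : forall (s : node) b v w, rho (val s) = Some v ->
  rho (rcons (val s) b) = Some w -> (w < v)%O.
Hypothesis rho_prefix : forall (s : node) u, rho (val s ++ u) -> rho (val s).
Hypothesis rho_node_at : forall i, rho (val (node_at i)).

(** The spikes to be considered are those at [s], finitely many of which count by
    [spike_null], and those located at the children of [s] or at their
    extensions; the children have smaller ranks. *)
Lemma heavy_finite delta (v : W) (s : node) : 0 < delta -> rho (val s) = Some v ->
  finite_set (heavy delta (val s)).
Proof.
move=> d0; elim/(well_founded_ind wfW): v s => v IH s sv.
pose B := [set b | heavy delta (rcons (val s) b) !=set0].
apply: (@sub_finite_set _ _ ([set i | delta <= f (j (spike R s i))] `|`
    \bigcup_(b in B) heavy delta (rcons (val s) b))).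
  move=> i [/prefixP[[|b u] tE] di]; [left|right].
    have -> : s = node_at i by apply: val_inj; rewrite tE cats0.
    exact: di.
  have hi : heavy delta (rcons (val s) b) i.
    by split=> //; rewrite tE -cat_rcons prefix_prefix.
  by exists b => //; exists i.
rewrite finite_setU; split; first exact: spike_null.
apply: bigcup_finite => [|b [i [/prefixP[u tE] di]]]; first exact: finite_heavy_children.
have : rho (val (child (val s) b)).
  by apply: (@rho_prefix _ u); rewrite -tE; exact: rho_node_at.
case E : (rho _) => [w|] // _.
exact: IH (rho_lt sv E) _ E.
Qed.

Lemma spikes_finite delta : 0 < delta ->
  finite_set [set i | delta <= f (j (spike R (node_at i) i))].
Proof.
move=> d0; pose B := [set b | heavy delta (rcons [::] b) !=set0].
apply: (@sub_finite_set _ _ (\bigcup_(b in B) heavy delta (rcons [::] b))).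
  move=> i di; case tE : (val (node_at i) : seq ordww) => [|b u].
    by have := valP (node_at i); rewrite /= tE.
  have hi : heavy delta (rcons [::] b) i by split=> //; rewrite tE /= eqxx prefix0s.
  by exists b => //; exists i.
apply: bigcup_finite => [|b [i [/prefixP[u tE] di]]]; first exact: finite_heavy_children.
have : rho (val (child [::] b)).
  by apply: (@rho_prefix _ u); rewrite -tE; exact: rho_node_at.
case E : (rho _) => [w|] // _.
exact: heavy_finite E.
Qed.

End WeaklyNull.

(** * Ranks on the tree and enumeration of the ranked nodes *)
Lemma finite_set_near_notin (A : set nat) : finite_set A -> \forall n \near \oo, ~ A n.
Proof.
move=> /finite_fsetP[B AB]; exists (\max_(i <- enum_fset B) i).+1 => // n /= Bn An.
have nB : n \in enum_fset B by have : A n by []; rewrite AB.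
by have := @leq_bigmax_seq _ _ xpredT id _ nB isT; rewrite leqNgt Bn.
Qed.

(** The index [i] is sent to the element of [P] whose code is the exponent of 2 in
    [i], if there is one. *)
Lemma infinitely_often (T : Type) (P : set T) : countable P -> P !=set0 ->
  exists t : nat -> T, (forall i, P (t i)) /\
    forall s, P s -> exists2 phi : nat -> nat,
      {homo phi : i i' / (i < i')%N} & forall q, t (phi q) = s.
Proof.
move=> /countable_injP[c c_inj] [s0 Ps0].
have /choice[t tP] i : exists s, P s /\ forall u, P u -> c u = logn 2 i -> s = u.
  have [[s [Ps cs]]|nos] := pselect (exists s, P s /\ c s = logn 2 i).
    exists s; split=> // u Pu cu.
    by apply: c_inj; [exact: mem_set|exact: mem_set|rewrite cs cu].
  by exists s0; split=> // u Pu cu; exfalso; apply: nos; exists u.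
exists t; split=> [i|s Ps]; first by have [] := tP i.
exists (fun q => (q.*2.+1 * 2 ^ c s)%N) => [q q' qq'|q].
  by rewrite ltn_pmul2r ?expn_gt0 // ltnS ltn_double.
have [_] := tP (q.*2.+1 * 2 ^ c s)%N; apply => //.
by rewrite logn_Gauss ?pfactorK // coprime2n /= odd_double.
Qed.

Section Ranks.
Variables (d : Order.disp_t) (W : orderType d).

(** [c k] is the maximum of the elements below [w] whose code is less than [k], if
    there are any. *)
Lemma child_ranks (w : W) : countable [set v : W | (v < w)%O] ->
  exists c : nat -> option W, (forall k v, c k = Some v -> (v < w)%O) /\
    forall v, (v < w)%O -> exists K, forall k, (K <= k)%N ->
      exists2 v', c k = Some v' & (v <= v')%O.
Proof.
move=> /countable_injP[n n_inj].
have /choice[c cP] k : exists r : option W, (forall v, r = Some v -> (v < w)%O) /\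
    forall v, (v < w)%O -> (n v < k)%N -> exists2 v', r = Some v' & (v <= v')%O.
  elim: k => [|k [r [rw rP]]]; first by exists None.
  have [[u [uw nu]]|nou] := pselect (exists u, (u < w)%O /\ n u = k); last first.
    exists r; split=> // v vw; rewrite ltnS leq_eqVlt => /predU1P[nv|]; last exact: rP.
    by exfalso; apply: nou; exists v.
  have uE v : (v < w)%O -> n v = k -> v = u.
    by move=> vw nv; apply: n_inj; [exact: mem_set|exact: mem_set|rewrite nu nv].
  case: r rw rP => [x|] rw rP.
    exists (Some (Order.max x u)); split=> [v [<-]|v vw H].
      by rewrite gt_max uw rw.
    exists (Order.max x u) => //; rewrite le_max.
    move: H; rewrite ltnS leq_eqVlt => /predU1P[/(uE _ vw)->|/(rP _ vw)[x' [->] ->//]].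
    by rewrite lexx orbT.
  exists (Some u); split=> [v [<-//]|v vw]; rewrite ltnS leq_eqVlt.
  by move=> /predU1P[/(uE _ vw)->|/(rP _ vw)[]//]; exists u.
exists c; split=> [k v|v vw]; first by have [+ _] := cP k; apply.
by exists (n v).+1 => k nk; have [_] := cP k; apply.
Qed.

End Ranks.

Section RankedTree.
Variables (d : Order.disp_t) (W : orderType d) (alpha : W).
Hypothesis alpha_countable : countable [set v : W | (v < alpha)%O].

(** The rank of a child depends on the rank [v] of its parent and on the leading
    exponent of its last coordinate, through the function given by [child_ranks] for
    [v].  The root [ [::] ], which is not a node, is left without rank. *)
Lemma ranked_tree : exists rho : seq ordww -> option W,
  [/\ forall b, rho [:: b] = Some alpha,
      forall (s : node) b v w, rho (val s) = Some v ->
        rho (rcons (val s) b) = Some w -> (w < v)%O,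
      forall (s : node) u, rho (val s ++ u) -> rho (val s) &
      forall (s : node) v w, rho (val s) = Some v -> (w < v)%O ->
        exists K, forall b, (K <= head 0 (val b))%N ->
          exists2 w', rho (rcons (val s) b) = Some w' & (w <= w')%O].
Proof.
have /choice[c cP] (v : W) : exists c : nat -> option W, (v <= alpha)%O ->
    (forall k w, c k = Some w -> (w < v)%O) /\
    forall w, (w < v)%O -> exists K, forall k, (K <= k)%N ->
      exists2 w', c k = Some w' & (w <= w')%O.
  have [va|] := boolP (v <= alpha)%O; last by exists (fun=> None).
  have [|c cP] := @child_ranks _ _ v; last by exists c.
  by apply: sub_countable alpha_countable; apply: subset_card_le => w /lt_le_trans; exact.
pose step (o : option W) (b : ordww) :=
  if o is Some v then c v (head 0%N (val b)) else None.
pose rho s := if s is _ :: l then foldl step (Some alpha) l else None.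
have rhoS (s : node) b : rho (rcons (val s) b) = step (rho (val s)) b.
  by case: s => -[|a s] //= _; rewrite foldl_rcons.
have rho_le s v : rho s = Some v -> (v <= alpha)%O.
  case: s => //= a s; elim/last_ind: s v => [v [<-]//|s b IH v].
  rewrite foldl_rcons; case E : (foldl _ _ _) => [u|] //=.
  by move=> /(cP _ (IH _ E)).1 /ltW /le_trans; apply; exact: IH.
exists rho; split=> //.
- move=> s b v w sv; rewrite rhoS sv /=; exact: (cP _ (rho_le _ _ sv)).1.
- case=> -[|a s] //= _ u; rewrite foldl_cat; case: (foldl _ _ s) => //.
  by elim: u.
- move=> s v w sv wv; have [K KP] := (cP _ (rho_le _ _ sv)).2 _ wv.
  by exists K => b /KP; rewrite rhoS sv.
Qed.

End RankedTree.

(** * Weak-star limits of path functionals *)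
Lemma ltxi_head (a b : lex) : (head 0%N a < head 0%N b)%N -> (a < b)%O.
Proof.
case: b => [|y b]; first by rewrite ltn0.
case: a => [|x a] //= xy; rewrite ltxi_cons leEnat (ltnW xy) /=.
by rewrite leqNgt xy.
Qed.

Section Functionals.
Variables (R : realType) (X : completeNormedModType R) (j : {linear X0 R -> X}).
Hypothesis Xcompl : is_completion j.

Lemma path_functional_extension : exists h : node -> {ptws X -> R},
  (forall s, dual_ball (h s)) /\ forall s F, h s (j F) = path_functional s F.
Proof.
have H s : exists h : {ptws X -> R}, dual_ball h /\ forall F, h (j F) = path_functional s F.
  have [h hb hF] := extend_contraction Xcompl.2
    (segment_fun_is_linear (inl s, 1%N)) (path_functional_le Xcompl s).
  by exists h.
have [h hP] := choice H.
by exists h; split=> s; have [] := hP s.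
Qed.

Lemma C0_tail (g : ordww1 -> R) (e : R) : C0 g -> 0 < e ->
  exists K, forall b : ordww, (K <= head 0 (val b))%N -> `|g (Some b)| < e.
Proof.
move=> [gc g0] e0.
have gN : g x @[x --> (None : order_topology ordww1)] --> g None by exact: gc.
rewrite g0 in gN.
have : nbhs (None : order_topology ordww1) [set x | `|g x| < e].
  by move/cvgr0Pnorm_lt : gN => /(_ _ e0).
rewrite itv_nbhsE => -[[l r] [iopen iN] ig].
suff [K Ki] : exists K, forall b : ordww, (K <= head 0%N (val b))%N ->
    (l <= BLeft (Some b : ordww1))%O.
  exists K => b /Ki lb; apply: ig; rewrite /= itv_boundlr lb /=.
  by move: iN; rewrite itv_boundlr => /andP[_]; apply: le_trans.
case: l iopen iN {ig} => [c [a|]|[]] // iopen iN; last by exists 0%N.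
  exists (head 0%N (val a)).+1 => b ab.
  have ltab : (a < b)%O by rewrite ltEsub; exact: ltxi_head.
  by case: c {iopen iN}; rewrite bnd_simp ?lt_Some ?le_Some // ltW.
by case: c iopen iN.
Qed.

Variable h : node -> {ptws X -> R}.
Hypothesis h_ball : forall s, dual_ball (h s).
Hypothesis h_path : forall s F, h s (j F) = path_functional s F.

Lemma dual_ballB (f : X -> R) x y : dual_ball f -> f (x - y) = f x - f y.
Proof. by move=> [fL _]; rewrite addrC -scaleN1r fL scaleN1r addrC. Qed.

(** The filter of neighborhoods of [w^w], restricted to the ordinals below it. *)
Definition tails : set_system ordww :=
  filter_from [set: nat] (fun K => [set b : ordww | (K <= head 0%N (val b))%N]).

#[local] Instance tails_filter : Filter tails.
Proof.
apply: filter_from_filter; first by exists 0%N.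
by move=> K L _ _; exists (maxn K L) => // b /=; rewrite geq_max => /andP[].
Qed.

(** On the dense subspace the difference of the two functionals at [F] is the value of
    [F s] at [b] ([path_functional_child]), which tends to 0 as [F s] is in [C_0]. *)
Lemma child_functionals_cvg s : (fun b => h (child (val s) b)) @ tails --> h s.
Proof.
apply/(@pointwise_cvgP X R) => x /=.
apply/cvgrPdist_lt => e e0; have e3 : 0 < e / 3 by rewrite divr_gt0.
have [F xF] := dense_approx Xcompl.2 x e3.
have /asboolP[/(_ s) Fs _] := valP F.
have [K KP] := C0_tail Fs e3.
exists K => // b /KP gb.
have near_x (f : X -> R) : dual_ball f -> `|f x - f (j F)| < e / 3.
  by move=> fb; rewrite -dual_ballB //; apply: le_lt_trans xF; exact: fb.2.
have := near_x _ (h_ball s); have := near_x _ (h_ball (child (val s) b)).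
rewrite !h_path path_functional_child; move: gb.
set u := val F s _; set p := path_functional s F.
set y := h s x; set z := h _ x => uE zE yE.
suff : `|y - z| < e by [].
have -> : y - z = (y - p) + (- u) + (u + p - z) by ring.
apply: le_lt_trans (ler_normD _ _) _.
apply: (@lt_le_trans _ _ (e / 3 + e / 3 + e / 3)); last by lra.
apply: ltrD; last by rewrite distrC.
by apply: le_lt_trans (ler_normD _ _) _; rewrite normrN; exact: ltrD.
Qed.

End Functionals.

(** * Lower bound for the index *)
Section LowerBound.
Variables (R : realType) (X : completeNormedModType R) (j : {linear X0 R -> X}).
Hypothesis Xcompl : is_completion j.
Variables (d : Order.disp_t) (W : orderType d).
Hypothesis wfW : well_founded (fun v w : W => (v < w)%O).
Variables (rho : seq ordww -> option W) (node_at : nat -> node) (h : node -> {ptws X -> R}).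
Hypothesis rho_child : forall (s : node) v w, rho (val s) = Some v -> (w < v)%O ->
  exists K, forall b, (K <= head 0%N (val b))%N ->
    exists2 w', rho (rcons (val s) b) = Some w' & (w <= w')%O.
Hypothesis node_at_often : forall s : node, rho (val s) ->
  exists2 phi : nat -> nat, {homo phi : i i' / (i < i')%N} & forall q, node_at (phi q) = s.
Hypothesis h_ball : forall s, dual_ball (h s).
Hypothesis h_path : forall s F, h s (j F) = path_functional s F.

Let x n := j (spike R (node_at n) n).

(** The spikes at [s] with indices [phi i] all take the value 1 on the functional of
    a common child of [s], given by [common_descents], which lies in [N]. *)
Lemma l1SP_children (N : set {ptws X -> R}) (s : node) (phi : nat -> nat) (K0 : nat) :
  N `<=` @dual_ball R X -> {homo phi : i i' / (i < i')%N} ->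
  (forall q, node_at (phi q) = s) ->
  (forall b, (K0 <= head 0%N (val b))%N -> N (h (child (val s) b))) ->
  l1SP N (fun i (f : {ptws X -> R}) => f (x (phi i))) = 1.
Proof.
move=> Nb phiS phis Nh; apply: l1SP_eq1 => [i f /Nb[_ /(_ (x (phi i)))]|k].
  by rewrite (norm_spike Xcompl).
have phi_ge i : (i <= phi i)%N by elim: i => // i /leq_ltn_trans; apply; exact: phiS.
exists (maxn k K0) => n nM nS.
have [||b bK bn] := @common_descents [seq phi (n i) | i <- enum 'I_k] (maxn k K0).
- by rewrite size_map size_enum_ord leq_maxl.
- by move=> _ /mapP[i _ ->]; exact: leq_trans (nM i) (phi_ge _).
exists (h (child (val s) b)); first by apply: Nh; rewrite bK leq_maxr.
rewrite (eq_bigr (fun=> 1)) ?sumr_const ?card_ord // => i _.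
rewrite h_path phis path_functional_child_spike bn //.
by apply/mapP; exists i => //; rewrite mem_enum.
Qed.

Lemma path_functional_derived w (s : node) v : rho (val s) = Some v -> (w <= v)%O ->
  derived_set (1 / 2) x wfW w (h s).
Proof.
elim/(well_founded_ind wfW): w s v => w IH s v sv wv.
rewrite derived_setE /derived_step; case: pselect => [succ_w|_]; last first.
  split=> [|u uw]; first exact: h_ball.
  exact: (IH u uw s v sv (ltW (lt_le_trans uw wv))).
case: (cid succ_w) => u [uw _] /=.
have uv := lt_le_trans uw wv.
split=> [|U Us]; first exact: (IH u uw s v sv (ltW uv)).
have [|phi phiS phis] := @node_at_often s; first by rewrite sv.
exists phi => //.
have [K1 K1P] := rho_child sv uv.
have [K2 _ K2P] := child_functionals_cvg Xcompl h_ball h_path Us.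
rewrite (@l1SP_children _ s phi (maxn K1 K2)) //; first by lra.
  by move=> f [_ /derived_set_sub_ball].
move=> b; rewrite geq_max => /andP[/K1P[w' bw' uw'] bK2]; split; first exact: K2P.
exact: (IH u uw (child (val s) b) w' bw' uw').
Qed.

End LowerBound.

(* Ordinals are the elements of an arbitrary uncountable well-ordered set [W]:
   as [W] contains a copy of omega_1, every countable ordinal occurs in it, and
   the countable ordinals are the elements with countably many predecessors. *)
Theorem corollary6p6 (R : realType)
    (X : completeNormedModType R) (j : {linear X0 R -> X})
    (Xcompl : is_completion j)
    (d : Order.disp_t) (W : orderType d)
    (wfW : well_founded (fun v w : W => (v < w)%O))
    (uncountableW : ~ countable [set: W])
    (alpha : W) (alpha_countable : countable [set v : W | (v < alpha)%O]) :
  exists x : nat -> X,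
    [/\ forall n, `|x n| = 1,
        weakly_null x &
        exists2 o : W, is_averaging_index (1 / 2) x wfW o & (alpha <= o)%O].
Proof.
have [rho [rho_root rho_lt rho_prefix rho_child]] := ranked_tree alpha_countable.
have nodes_countable : countable [set s : node | rho (val s)].
  apply/countable_injP.
  exists (fun s => choice.pickle (map (fun b : ordww => val b : seq nat) (val s))).
  move=> s u _ _ /(pcan_inj choice.pickleK) /inj_map su; apply: val_inj; apply: su.
  by move=> b c bc; exact: val_inj.
have [|node_at [rho_node_at node_at_often]] := infinitely_often nodes_countable.
  by exists (child [::] ordww0); rewrite /= rho_root.
have [h [h_ball h_path]] := path_functional_extension Xcompl.
pose x n := j (spike R (node_at n) n).
have x_null (f : {linear X -> R^o}) (C : R) : (forall y, `|f y| <= C * `|y|) ->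
    f (x n) @[n --> \oo] --> (0 : R).
  move=> fC; apply/cvgr0Pnorm_lt => e e0.
  have fin (g : {linear X -> R^o}) : (forall y, `|g y| <= C * `|y|) ->
      \forall n \near \oo, g (x n) < e.
    move=> gC; have := finite_set_near_notin
      (spikes_finite Xcompl gC wfW rho_lt rho_prefix rho_node_at e0).
    by apply: filterS => n /negP; rewrite -ltNge.
  have Nf (g : {linear X -> R^o}) : (forall y, g y = - f y) ->
      \forall n \near \oo, - f (x n) < e.
    move=> gE; have gC y : `|g y| <= C * `|y| by rewrite gE normrN.
    by have := fin g gC; apply: filterS => n; rewrite gE.
  have := fin f fC; have := Nf (\- f) (fun=> erefl).
  by apply: filterS2 => n fn nf; rewrite ltr_norml ltrNl fn.
have x_ball_null (f : {ptws X -> R}) : dual_ball f -> f (x n) @[n --> \oo] --> (0 : R).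
  move=> [fL f1].
  pose g : {linear X -> R^o} :=
    HB.pack (f : X -> R^o) (GRing.isLinear.Build R X R^o _ f fL).
  by apply: (x_null g 1) => y; rewrite mul1r; exact: f1.
have half0 : 0 < 1 / 2 :> R by lra.
have [p pP] := averaging_index_exists half0 x_ball_null wfW uncountableW.
exists x; split=> [n|f fc|]; first exact: norm_spike.
  have /linear_boundedP : bounded_near f (nbhs (0 : X)).
    exact: continuous_linear_bounded (fc 0).
  move=> [M [_ /(_ (M + 1))]]; rewrite ltrDl ltr01 => /(_ isT).
  exact: x_null.
exists p => //; apply: pP.2; exists (h (child [::] ordww0)).
exact: (path_functional_derived Xcompl wfW rho_child node_at_often h_ball h_path
  (rho_root _) (lexx _)).
Qed.
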